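(* Suppose that $M$ is a Hölder continuous function on $\Sigma_A$ taking values in the set of positive $d\times d$ matrices (all entries strictly positive). Then the pressure function $P(q)$ of $M$ is differentiable at every $q\in\mathbb{R}$ with $q\neq 0$.
   Context: Let $m\ge 2$, $\Sigma=\{1,\dots,m\}^{\mathbb{N}}$, with the left shift $\sigma$ and the metric $d(x,y)=m^{-n}$ for $x\neq y$, where $n$ is the smallest $k$ with $x_k\ne y_k$. Let $A$ be an $m\times m$ matrix with entries $0$ or $1$, assumed primitive (some power $A^p$ has all entries strictly positive). $\Sigma_A=\{x\in\Sigma: A_{x_k,x_{k+1}}=1\ \text{for all } k\}$ is the associated subshift of finite type. $\Sigma_{A,n}$ is the set of admissible words $J=j_1\cdots j_n$ of length $n$ over $\{1,\dots,m\}$ (that is, $A_{j_k,j_{k+1}}=1$ for $1\le k<n$), and $[J]=\{x\in\Sigma_A: x_i=j_i,\ 1\le i\le n\}$ is the cylinder set. The matrix norm is $\|B\|=\mathbf{1}^tB\mathbf{1}$ with $\mathbf{1}^t=(1,\dots,1)$ (the sum of all entries). The pressure function of $M$ is $$P(q)=\lim_{n\to\infty}\frac1n\log\sum_{J\in\Sigma_{A,n}}\ \sup_{x\in[J]}\|M(x)M(\sigma x)\cdots M(\sigma^{n-1}x)\|^q,$$ the limit existing for every $q\in\mathbb{R}$ in this setting. *)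

(* Defs.v *)
From mathcomp Require Import all_boot all_order all_algebra.
From mathcomp Require Import all_classical all_reals all_analysis.

Set Implicit Arguments.
Unset Strict Implicit.
Unset Printing Implicit Defensive.

Import Order.TTheory GRing.Theory Num.Theory.
Import numFieldNormedType.Exports.

Local Open Scope classical_set_scope.
Local Open Scope ring_scope.

(* Points of the full shift are x : nat -> 'I_m; the coordinate x_k (k >= 1)
   is x k.-1, hence the ".+1" in the exponent of the metric. *)

Definition shift (T : Type) (x : nat -> T) : nat -> T := fun k => x k.+1.

Definition symb_dist (R : realType) (m : nat) (x y : nat -> 'I_m) : R :=
  if pselect (exists k, x k != y k) is left neq_xy
  then m%:R ^- (ex_minn neq_xy).+1 else 0.

Definition zero_one_mx (m : nat) (A : 'M[nat]_m) : Prop :=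
  forall i j, A i j = 0%N \/ A i j = 1%N.

Definition primitive_mx (m : nat) (A : 'M[nat]_m) : Prop :=
  exists2 p : nat, (0 < p)%N & forall i j, (0 < (A ^+ p) i j)%N.

Definition subshift (m : nat) (A : 'M[nat]_m) : set (nat -> 'I_m) :=
  [set x | forall k, A (x k) (x k.+1) = 1%N].

Definition admissible (m : nat) (A : 'M[nat]_m) (n : nat)
    (J : n.-tuple 'I_m) : bool :=
  sorted (fun i j => A i j == 1%N) J.

Definition cylinder (m : nat) (A : 'M[nat]_m) (n : nat)
    (J : n.-tuple 'I_m) : set (nat -> 'I_m) :=
  [set x | subshift A x /\ forall i : 'I_n, x i = tnth J i].

Definition sum_norm (R : realType) (d : nat) (B : 'M[R]_d) : R :=
  \sum_i \sum_j B i j.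

Definition cocycle (R : realType) (m d : nat) (M : (nat -> 'I_m) -> 'M[R]_d)
    (n : nat) (x : nat -> 'I_m) : 'M[R]_d :=
  \prod_(i < n) M (iter i (@shift _) x).

Definition pressure (R : realType) (m d : nat) (A : 'M[nat]_m)
    (M : (nat -> 'I_m) -> 'M[R]_d) (q : R) : R :=
  lim ((fun n : nat => n%:R^-1 *
    ln (\sum_(J : n.-tuple 'I_m | admissible A J)
          sup [set sum_norm (cocycle M n x) `^ q | x in cylinder A J]))
    @ \oo).

(* `|_| is the max norm on matrices; all matrix norms give the same notion. *)
Definition hoelder_on (R : realType) (m d : nat) (D : set (nat -> 'I_m))
    (M : (nat -> 'I_m) -> 'M[R]_d) : Prop :=
  exists C alpha : R, 0 < alpha /\
    forall x y, D x -> D y ->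
      `|M x - M y| <= C * symb_dist R x y `^ alpha.

Definition positive_mx (R : realType) (d : nat) (B : 'M[R]_d) : Prop :=
  forall i j, 0 < B i j.

(* Main.v *)
Require Import Defs.
From mathcomp Require Import all_boot all_order all_algebra.
From mathcomp Require Import all_classical all_reals all_analysis.
From mathcomp Require Import ring lra.
Set Implicit Arguments.
Unset Strict Implicit.
Unset Printing Implicit Defensive.
Import Order.TTheory GRing.Theory Num.Theory.
Import numFieldNormedType.Exports.
Local Open Scope classical_set_scope.
Local Open Scope ring_scope.

(** The pressure is a limit of averages of logarithms of sums of exponentials,
    one for each length n.  It is differentiable because the second derivatives
    of these averages, which are variances of a Birkhoff sum divided by n, are
    bounded uniformly in n; boundedness of the variance per letter follows
    from decay of correlations.

    _Reduction to words._  Complete every admissible word J to a point of the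
    subshift that starts with J, let F(J) be the norm of the product along J at
    this point, and S(J) = ln F(J).  Bounded distortion
    ([sum_norm_distortion]) says that the supremum over the cylinder of J of
    the q-th powers of the norms is exp(q S(J)) up to a factor that depends on
    q only, so the pressure at q is the growth rate of the sums of exp(q S(J))
    over the words of length n.  Adding a letter j in front of J changes S by
    an increment that hardly depends on the far end of J: the product of
    positive matrices along J contracts the directions of positive vectors
    exponentially fast ([proj_close_mxapply], [proj_close_row_sums]), so two
    words with a common prefix of length n have increments that differ by at
    most C kappa^n with kappa < 1 ([incr_word_log_regular]).  From here on the
    matrices disappear: only the function S on words and this regularity
    matter.

    _Transfer operator._ Up to a constant factor the sums above are the values
    at the empty word of the iterates on the constant 1 of the operator L_q
    which maps u to L_q u(w) = sum over the letters j that may precede w of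
    exp(q (S(jw) - S(w))) u(jw). It maps positive functions with a logarithm
    that is Lipschitz for the prefix metric to functions of the same kind, with
    a smaller constant if that constant is large, and by primitivity a fixed
    power of it makes the values of such a function comparable. A definite
    proportion of a reference function can therefore be split off at each step,
    and the ratio of the iterates of two regular functions becomes constant
    exponentially fast ([contraction_osc]).

    _Perturbation of the exponent._  Write h_n = L_q^n 1 and let d_n(w) be the
    mean of the Birkhoff sum S(Jw) - S(w) over the words J of length n, with
    the weights that define h_n(w).  The contraction, applied to every letter
    of J separately, yields a geometric series which bounds the oscillation of
    d_n independently of n ([drift_osc]).  Moreover d_(n+1) is obtained from
    d_n by averaging the function (increment + d_n), which stays within a
    bounded distance of its mean, so the second order expansion of the
    exponential around the mean gives by induction
    h_n exp(t d_n) <= L_(q+t)^n 1 <= h_n exp(t d_n + E t^2 n)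
    ([weight_shift]).  After taking logarithms and dividing by n, two difference
    quotients with steps s and t differ by at most a constant times |s| + |t|;
    this passes to the limit, so the difference quotients of the pressure are
    Cauchy ([derivable_lim]).  The limit that defines the pressure exists
    because the logarithms of the sums are additive in n up to a bounded error
    ([weight_quasi_multiplicative], [cvg_nearly_additive]).  *)

(** * Nearly additive sequences, derivatives of limits, exponential averages *)

Lemma cvg_invn (R : realType) : (n%:R^-1 : R) @[n --> \oo] --> (0 : R).
Proof. by rewrite -cvg_shiftS; exact: cvg_harmonic. Qed.

(** Iterating the hypothesis k times bounds a(kn) - k a(n) by k E, so a(n)/n is
    within E/n of a(kn)/(kn).  By symmetry a(n)/n and a(k)/k are both close to
    a(kn)/(kn); this gives the Cauchy property without subadditivity. *)
Lemma cvg_nearly_additive (R : realType) (a : nat -> R) (E : R) (p : nat) :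
  (forall k n, (0 < k)%N -> (p <= n)%N -> `|a (k + n)%N - a k - a n| <= E) ->
  cvg ((fun n => n%:R^-1 * a n) @ \oo).
Proof.
move=> aE; have E0 : 0 <= E by apply: le_trans (aE 1%N p isT (leqnn p)).
(* k.+1 keeps the number k of applications of the hypothesis explicit. *)
have mulE k n : (0 < n)%N -> (p <= n)%N -> `|a (k.+1 * n)%N - k.+1%:R * a n| <= k%:R * E.
  move=> n0 pn; elim: k => [|k IH]; first by rewrite !mul1n mul1r subrr normr0 mul0r.
  rewrite mulSn addnC.
  have h := aE (k.+1 * n)%N n _ pn; rewrite muln_gt0 n0 in h.
  have -> : a (k.+1 * n + n)%N - k.+2%:R * a n =
    (a (k.+1 * n + n)%N - a (k.+1 * n)%N - a n) + (a (k.+1 * n)%N - k.+1%:R * a n).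
    by rewrite -(natr1 k.+1); ring.
  apply: (le_trans (ler_normD _ _)).
  have -> : k.+1%:R * E = E + k%:R * E by rewrite -natr1; ring.
  by rewrite lerD ?h.
have oneE k n : (0 < k)%N -> (0 < n)%N -> (p <= n)%N ->
    `|a (k * n)%N / (k * n)%:R - n%:R^-1 * a n| <= E / n%:R.
  case: k => // k _ n0 pn; have n0' : 0 < n%:R :> R by rewrite ltr0n.
  have k0' : 0 < k.+1%:R :> R by rewrite ltr0n.
  have kn0 : 0 < (k.+1 * n)%:R :> R by rewrite natrM mulr_gt0.
  have -> : a (k.+1 * n)%N / (k.+1 * n)%:R - n%:R^-1 * a n =
      (a (k.+1 * n)%N - k.+1%:R * a n) / (k.+1 * n)%:R.
    by rewrite natrM; field; rewrite !gt_eqF.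
  rewrite normrM normfV (gtr0_norm kn0) ler_pdivrMr //.
  apply: (le_trans (mulE k n n0 pn)).
  have -> : E / n%:R * (k.+1 * n)%:R = k.+1%:R * E.
    by rewrite natrM; field; rewrite gt_eqF.
  by rewrite ler_wpM2r // ler_nat.
apply: cauchy_cvg; apply: cauchy_exP => eps eps0.
have [N [N0 pN NE]] : exists N, [/\ (0 < N)%N, (p <= N)%N & E / N%:R < eps / 2].
  pose N0 := Num.truncn (E / (eps / 2)).
  exists (maxn p N0.+1); split; [by rewrite leq_max orbT|exact: leq_maxl|].
  have e2 : 0 < eps / 2 by rewrite divr_gt0.
  rewrite ltr_pdivrMr ?ltr0n ?leq_max ?orbT // mulrC -ltr_pdivrMr //.
  apply: (@lt_le_trans _ _ N0.+1%:R); last by rewrite ler_nat leq_maxr.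
  exact: truncnS_gt.
exists (N%:R^-1 * a N).
suff : \forall n \near \oo, ball (N%:R^-1 * a N) eps (n%:R^-1 * a n) by [].
near=> n.
have Nn : (N <= n)%N by near: n; exact: nbhs_infty_ge.
have n0 : (0 < n)%N by apply: leq_trans Nn.
have h1 := oneE n N n0 N0 pN; have h2 := oneE N n N0 n0 (leq_trans pN Nn).
have h3 : E / n%:R <= E / N%:R by rewrite ler_wpM2l // lef_pV2 ?posrE ?ltr0n // ler_nat.
rewrite [(N * n)%N]mulnC in h2; rewrite /ball /= /ball_ /=.
move: h1 h2 h3 NE; move: (a (n * N)%N / _) (N%:R^-1 * _) (n%:R^-1 * _) => x y z.
move: (E / n%:R) (E / N%:R) => e1 e2.
by rewrite !ler_norml ltr_norml; lra.
Unshelve. all: by end_near.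
Qed.

(** The slope v(n)/n of the approximation may depend on n: dividing by t and by
    n, two difference quotients of z(.)(n)/n with steps s and t differ by
    C (|s| + |t|) up to O(1/n), a bound without v, and it survives the limit in
    n.  The error E may depend on t since it is divided by n. *)
Lemma derivable_lim (R : realType) (z : R -> nat -> R) (v : nat -> R) (q C delta : R) :
  0 < delta -> 0 <= C ->
  (forall s, cvg ((fun n => n%:R^-1 * z s n) @ \oo)) ->
  (forall t, `|t| <= delta -> exists E, forall n, (0 < n)%N ->
     `|z (q + t) n - z q n - t * v n| <= C * t ^+ 2 * n%:R + E) ->
  derivable (fun s => lim ((fun n => n%:R^-1 * z s n) @ \oo)) q 1.
Proof.
move=> d0 C0 zc ze; set f := fun s => _.
have fE s : (fun n => n%:R^-1 * z s n) @ \oo --> f s by exact: zc.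
have key s t : `|s| <= delta -> `|t| <= delta ->
    `|s * (f (q + t) - f q) - t * (f (q + s) - f q)| <=
    C * (`|s| * t ^+ 2 + `|t| * s ^+ 2).
  move=> sd td; have [Es hs] := ze s sd; have [Et ht] := ze t td.
  have l1 : `|s * (n%:R^-1 * z (q + t) n - n%:R^-1 * z q n)
      - t * (n%:R^-1 * z (q + s) n - n%:R^-1 * z q n)| @[n --> \oo] -->
    `|s * (f (q + t) - f q) - t * (f (q + s) - f q)|.
    by apply: cvg_norm; apply: cvgB; apply: cvgMr; apply: cvgB; exact: fE.
  have l2 : C * (`|s| * t ^+ 2 + `|t| * s ^+ 2) + (`|s| * Et + `|t| * Es) * n%:R^-1
      @[n --> \oo] --> C * (`|s| * t ^+ 2 + `|t| * s ^+ 2)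
        + (`|s| * Et + `|t| * Es) * 0.
    by apply: cvgD; [exact: cvg_cst|apply: cvgMr; exact: cvg_invn].
  rewrite mulr0 addr0 in l2.
  apply: (ler_cvg_to l1 l2); near=> n.
  have n0 : (0 < n)%N by near: n; exact: nbhs_infty_gt.
  have n0' : 0 < n%:R :> R by rewrite ltr0n.
  have -> : s * (n%:R^-1 * z (q + t) n - n%:R^-1 * z q n) -
      t * (n%:R^-1 * z (q + s) n - n%:R^-1 * z q n) =
    n%:R^-1 * (s * (z (q + t) n - z q n - t * v n)
      - t * (z (q + s) n - z q n - s * v n)) by ring.
  rewrite normrM normfV (gtr0_norm n0') ler_pdivrMl //.
  apply: (le_trans (ler_normB _ _)); rewrite !normrM.
  have -> : n%:R * (C * (`|s| * t ^+ 2 + `|t| * s ^+ 2) +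
      (`|s| * Et + `|t| * Es) / n%:R) =
     `|s| * (C * t ^+ 2 * n%:R + Et) + `|t| * (C * s ^+ 2 * n%:R + Es).
    by field; rewrite gt_eqF.
  by rewrite lerD // ler_wpM2l // ?ht ?hs.
apply: cauchy_cvg; apply: cauchy_exP => eps eps0.
(* The quotient at the fixed step s is within 2 C s < eps of those at smaller steps. *)
pose s := Num.min delta (eps / (4 * (C + 1))).
have C1 : 0 < 4 * (C + 1) by lra.
have s0 : 0 < s by rewrite lt_min d0 divr_gt0.
have sd : s <= delta by rewrite ge_min lexx.
have sC : s * (4 * (C + 1)) <= eps by rewrite -ler_pdivlMr // ge_min lexx orbT.
exists (s^-1 * (f (q + s) - f q)).
suff : \forall t \near 0^', ball (s^-1 * (f (q + s) - f q)) eps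
    (t^-1 *: ((f \o shift q) (t *: 1) - f q)) by [].
near=> t.
have tn0 : t != 0 by near: t; exact: nbhs_dnbhs_neq.
have ts : `|t| <= s by near: t; apply: dnbhs0_le.
rewrite /ball /= /ball_ /= -[t *: 1]/(t * 1) mulr1 -[_ *: (_ - _)]/(t^-1 * _) (addrC t q).
have t0 : 0 < `|t| by rewrite normr_gt0.
have := key s t; rewrite (gtr0_norm s0) => /(_ sd (le_trans ts sd)) h.
have -> : s^-1 * (f (q + s) - f q) - t^-1 * (f (q + t) - f q) =
    - ((s * (f (q + t) - f q) - t * (f (q + s) - f q)) / (s * t)).
  by field; rewrite tn0 gt_eqF.
rewrite normrN normrM normfV normrM (gtr0_norm s0) ltr_pdivrMr ?mulr_gt0 //.
apply: (le_lt_trans h).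
rewrite -(real_normK (num_real t)); move: (`|t|) t0 ts => r r0 rs.
have -> : C * (s * r ^+ 2 + r * s ^+ 2) = s * r * (C * (r + s)) by ring.
rewrite mulrC ltr_pM2r ?mulr_gt0 //.
have : C * (r + s) <= C * (s + s) by rewrite ler_wpM2l // lerD2r.
have : 0 <= C * s by rewrite mulr_ge0 // ltW.
lra.
Unshelve. all: by end_near.
Qed.

(** Both sides vanish at omega = 0; the left side grows at rate at most
    (2K - 1) e^K and the difference on the right at rate at least 1. *)
Lemma expR_gap (R : realType) (K omega : R) : 1 <= K -> 0 <= omega <= 1 ->
  expR (K * omega) - expR (- ((K - 1) * omega)) <=
  2 * K * expR K * (expR (K * omega) - expR ((K - 1) * omega)).
Proof.
move=> K1 /andP[w0 w1].
have eK : 0 < expR K := expR_gt0 K.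
apply: (@le_trans _ _ (2 * K * expR K * omega)); last first.
  apply: ler_wpM2l; first by rewrite mulr_ge0 ?ltW //; lra.
  have -> : K * omega = (K - 1) * omega + omega by ring.
  rewrite expRD; have h1 := expR_ge1Dx omega.
  have h2 : 1 <= expR ((K - 1) * omega).
    by rewrite -[leLHS]expR0 ler_expR mulr_ge0 // subr_ge0.
  nra.
have -> : - ((K - 1) * omega) = K * omega + - ((2 * K - 1) * omega) by ring.
rewrite expRD; have h1 := expR_ge1Dx (- ((2 * K - 1) * omega)).
have h2 : expR (K * omega) <= expR K by rewrite ler_expR ler_piMr //; lra.
have h3 := expR_gt0 (K * omega).
apply: (@le_trans _ _ (expR (K * omega) * ((2 * K - 1) * omega))); first by nra.
have -> : 2 * K * expR K * omega = expR K * (2 * K * omega) by ring.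
by apply: ler_pM => //; nra.
Qed.

Lemma expR_le_quadratic (R : realType) (y : R) :
  `|y| <= 2^-1 -> expR y <= 1 + y + 2 * y ^+ 2.
Proof.
rewrite ler_norml => /andP[y1 y2].
have h := expR_ge1Dx (- y); rewrite expRN in h.
have e0 := expR_gt0 y.
have h2 : (1 - y) * expR y <= 1 by rewrite -ler_pdivlMr // mul1r.
move: (expR y) e0 h2 => E E0 h2.
have h3 : (1 - y) * E <= (1 - y) * (1 + y + 2 * y ^+ 2).
  apply: (le_trans h2); have : 0 <= y ^+ 2 * (1 - 2 * y).
    by rewrite mulr_ge0 ?sqr_ge0 //; lra.
  by have -> : (1 - y) * (1 + y + 2 * y ^+ 2) = 1 + y ^+ 2 * (1 - 2 * y); [ring|lra].
by rewrite -(@ler_pM2l _ (1 - y)) //; lra.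
Qed.

(** Averages of an exponential around the mean: the first order term averages to
    zero, so the lower bound is Jensen's inequality and the upper bound costs
    only a second order term. *)
Lemma exponential_average (R : realType) (I : finType) (P : pred I)
    (a X : I -> R) (m t V : R) :
  (forall i, P i -> 0 <= a i) ->
  \sum_(i | P i) a i * X i = (\sum_(i | P i) a i) * m ->
  (forall i, P i -> `|X i - m| <= V) -> `|t| * V <= 2^-1 ->
  (\sum_(i | P i) a i) * expR (t * m) <= \sum_(i | P i) a i * expR (t * X i)
    <= (\sum_(i | P i) a i) * expR (t * m + 2 * t ^+ 2 * V ^+ 2).
Proof.
move=> a0 am XV tV.
have eE i : expR (t * X i) = expR (t * m) * expR (t * (X i - m)).
  by rewrite -expRD; congr expR; ring.
have sum0 : \sum_(i | P i) a i * (t * (X i - m)) = 0.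
  transitivity (t * (\sum_(i | P i) a i * X i - (\sum_(i | P i) a i) * m)).
    rewrite mulr_suml -sumrB mulr_sumr; apply: eq_bigr => i _; ring.
  by rewrite am subrr mulr0.
have -> : \sum_(i | P i) a i * expR (t * X i) =
    expR (t * m) * \sum_(i | P i) a i * expR (t * (X i - m)).
  by rewrite mulr_sumr; apply: eq_bigr => i _; rewrite eE mulrCA.
apply/andP; split.
  rewrite [leLHS]mulrC ler_wpM2l ?expR_ge0 //.
  have -> : \sum_(i | P i) a i =
      \sum_(i | P i) a i + \sum_(i | P i) a i * (t * (X i - m)).
    by rewrite sum0 addr0.
  rewrite -big_split /=.
  apply: ler_sum => i Pi; rewrite -{1}(mulr1 (a i)) -mulrDr.
  by rewrite ler_wpM2l ?a0 ?expR_ge1Dx.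
rewrite expRD mulrCA ler_wpM2l ?expR_ge0 //.
apply: (@le_trans _ _ (\sum_(i | P i) a i * (1 + t * (X i - m) + 2 * t ^+ 2 * V ^+ 2))).
  apply: ler_sum => i Pi; rewrite ler_wpM2l ?a0 //.
  apply: (le_trans (expR_le_quadratic _)).
    rewrite normrM; apply: le_trans tV; rewrite ler_wpM2l //; exact: XV.
  rewrite lerD2l exprMn mulrA; apply: ler_wpM2l.
    by rewrite mulr_ge0 // sqr_ge0.
  rewrite -[leLHS]real_normK ?num_real // ler_sqr ?nnegrE ?XV //.
  exact: le_trans (XV i Pi).
under eq_bigr do rewrite addrAC mulrDr.
rewrite big_split /= sum0 addr0 -mulr_suml.
by rewrite ler_wpM2l ?expR_ge1Dx // sumr_ge0.
Qed.

(** * The transfer operator on words *)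

Section TransferOperator.

Variables (R : realType) (T : finType) (e : rel T) (S : seq T -> R).

(** The potential of the transfer operator: what the first letter of w adds to
    S. *)
Definition incr (w : seq T) : R := S w - S (behead w).

(** A word is read as a past: its letters in front were added last, so the
    preimages of w under the shift are the words j :: w. *)
Definition transfer (q : R) (u : seq T -> R) (w : seq T) : R :=
  \sum_(j | path e j w) expR (q * incr (j :: w)) * u (j :: w).

Definition weight (q : R) (n : nat) : seq T -> R :=
  iter n (transfer q) (fun=> 1).

(** Exchanging b and b' shows that ln u is K-Lipschitz for the distance
    kappa^(length of the common prefix), on words that share a letter. *)
Definition prefix_regular (kappa K : R) (u : seq T -> R) : Prop :=
  (forall w, sorted e w -> 0 < u w) /\
  forall a b b', a != [::] -> sorted e (a ++ b) -> sorted e (a ++ b') ->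
    u (a ++ b) <= expR (K * kappa ^+ size a) * u (a ++ b').

Lemma transfer_lin q c (u v : seq T -> R) w :
  transfer q (fun x => c * u x + v x) w = c * transfer q u w + transfer q v w.
Proof.
rewrite /transfer mulr_sumr -big_split /=; apply: eq_bigr => j _.
by rewrite mulrDr mulrCA.
Qed.

Lemma iter_transfer_lin q n c (u v : seq T -> R) w :
  iter n (transfer q) (fun x => c * u x + v x) w =
  c * iter n (transfer q) u w + iter n (transfer q) v w.
Proof.
elim: n w => // n IH w.
by rewrite !iterS -transfer_lin; apply: eq_bigr => j _; rewrite IH.
Qed.

Lemma iter_transfer_scale q n c (u : seq T -> R) w :
  iter n (transfer q) (fun x => c * u x) w = c * iter n (transfer q) u w.
Proof.
elim: n w => // n IH w; rewrite !iterS /transfer mulr_sumr.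
by apply: eq_bigr => j _; rewrite IH mulrCA.
Qed.

Lemma transfer_mono q (u v : seq T -> R) :
  (forall w, sorted e w -> u w <= v w) ->
  forall w, sorted e w -> transfer q u w <= transfer q v w.
Proof.
move=> uv w _; apply: ler_sum => j jw.
by apply: ler_wpM2l; [exact: expR_ge0|exact: uv].
Qed.

Lemma iter_transfer_mono q n (u v : seq T -> R) :
  (forall w, sorted e w -> u w <= v w) ->
  forall w, sorted e w -> iter n (transfer q) u w <= iter n (transfer q) v w.
Proof. by move=> uv; elim: n => //= n IH w sw; apply: transfer_mono. Qed.

Lemma prefix_regular_le kappa K K' u : 0 <= kappa -> K <= K' ->
  prefix_regular kappa K u -> prefix_regular kappa K' u.
Proof.
move=> k0 KK' [u0 ur]; split=> // a b b' an ab ab'.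
apply: (le_trans (ur _ _ _ an ab ab')); apply: ler_wpM2r; first by rewrite ltW ?u0.
by rewrite ler_expR ler_wpM2r ?exprn_ge0.
Qed.

Lemma prefix_regularM kappa K K' u v :
  prefix_regular kappa K u -> prefix_regular kappa K' v ->
  prefix_regular kappa (K + K') (fun w => u w * v w).
Proof.
move=> [u0 ur] [v0 vr]; split=> [w sw|a b b' an ab ab'].
  by rewrite mulr_gt0 ?u0 ?v0.
rewrite mulrDl expRD mulrACA; apply: ler_pM.
- by rewrite ltW ?u0.
- by rewrite ltW ?v0.
- exact: ur.
- exact: vr.
Qed.

(** The increments of the n letters put in front of w telescope. *)
Lemma iter_transfer_sum q n (u : seq T -> R) w : sorted e w ->
  iter n (transfer q) u w =
  \sum_(J : n.-tuple T | sorted e (J ++ w))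
    expR (q * (S (J ++ w) - S w)) * u (J ++ w).
Proof.
move=> sw; elim: n u => [|n IH] u.
  rewrite (bigD1 [tuple]) //= big1 ?addr0 => [|J /andP[_]].
    by rewrite subrr mulr0 expR0 mul1r.
  by case/eqP; rewrite [J]tuple0.
rewrite iterSr IH.
rewrite (reindex (fun Jj : n.-tuple T * T => cons_tuple Jj.2 Jj.1)) /=; last first.
  exists (fun J : n.+1.-tuple T => (behead_tuple J, thead J)) => [[J j] _|J _] /=.
    by congr pair; apply: val_inj.
  by rewrite [RHS]tuple_eta; apply: val_inj.
transitivity (\sum_(J : n.-tuple T | sorted e (J ++ w)) \sum_(j | path e j (J ++ w))
    expR (q * (S (j :: J ++ w) - S w)) * u (j :: J ++ w)).
  apply: eq_bigr => J _; rewrite /transfer mulr_sumr; apply: eq_bigr => j _.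
  by rewrite mulrA -expRD /incr /=; congr (expR _ * _); ring.
rewrite pair_big_dep /=; apply: eq_bigl => -[J j] /=.
by apply: andb_idl; exact: path_sorted.
Qed.

Lemma weight_nil q n : weight q n [::] =
  \sum_(J : n.-tuple T | sorted e J) expR (q * (S J - S [::])).
Proof.
rewrite /weight iter_transfer_sum //; under eq_bigl do rewrite cats0.
by apply: eq_bigr => J _; rewrite cats0 mulr1.
Qed.

Variables (B C kappa : R) (p : nat).
Hypothesis B_ge0 : 0 <= B.
Hypothesis C_ge0 : 0 <= C.
Hypothesis kappa_gt0 : 0 < kappa.
Hypothesis kappa_lt1 : kappa < 1.
Hypothesis p_gt0 : (0 < p)%N.
Hypothesis T_gt0 : (0 < #|T|)%N.
Hypothesis incr_bound : forall w, sorted e w -> `|incr w| <= B.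
Hypothesis incr_regular : forall a b b', a != [::] ->
  sorted e (a ++ b) -> sorted e (a ++ b') ->
  incr (a ++ b) <= incr (a ++ b') + C * kappa ^+ size a.
Hypothesis mixing : forall i w, sorted e w ->
  exists a, [/\ size a = p, sorted e (a ++ w) & ohead a = Some i].

Let kappa_ge0 : 0 <= kappa := ltW kappa_gt0.

Lemma exists_predecessor w : sorted e w -> exists j, path e j w.
Proof.
move=> sw; have /card_gt0P[i _] := T_gt0.
have [a [sza saw _]] := mixing i sw.
case/lastP: a => [|a j] in sza saw; first by move: p_gt0; rewrite -sza.
by exists j; move: saw; rewrite cat_rcons => /cat_sorted2[].
Qed.

Lemma transfer_gt0 q u : (forall w, sorted e w -> 0 < u w) ->
  forall w, sorted e w -> 0 < transfer q u w.
Proof.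
move=> u0 w sw; have [j jw] := exists_predecessor sw.
rewrite /transfer (bigD1 j) //=; apply: ltr_pwDl.
  by rewrite mulr_gt0 ?expR_gt0 ?u0.
by apply: sumr_ge0 => i /andP[iw _]; rewrite mulr_ge0 ?expR_ge0 // ltW ?u0.
Qed.

Lemma iter_transfer_gt0 q n u : (forall w, sorted e w -> 0 < u w) ->
  forall w, sorted e w -> 0 < iter n (transfer q) u w.
Proof. by move=> u0; elim: n => //= n IH; apply: transfer_gt0. Qed.

Lemma weight_gt0 q n w : sorted e w -> 0 < weight q n w.
Proof. by apply: iter_transfer_gt0. Qed.

Lemma scaled_incr_le q w : sorted e w -> q * incr w <= `|q| * B.
Proof.
move=> sw; apply: (le_trans (ler_norm _)).
by rewrite normrM ler_wpM2l ?incr_bound.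
Qed.

Lemma scaled_incr_ge q w : sorted e w -> - (`|q| * B) <= q * incr w.
Proof.
move=> sw; rewrite lerNl -mulNr; apply: (le_trans (scaled_incr_le (- q) sw)).
by rewrite normrN.
Qed.

Lemma scaled_incr_regular q a b b' : a != [::] ->
  sorted e (a ++ b) -> sorted e (a ++ b') ->
  q * incr (a ++ b) <= q * incr (a ++ b') + `|q| * C * kappa ^+ size a.
Proof.
move=> an ab ab'; rewrite -lerBlDl -mulrBr; apply: (le_trans (ler_norm _)).
rewrite normrM -mulrA ler_wpM2l // ler_norml.
have := incr_regular an ab ab'; have := incr_regular an ab' ab; lra.
Qed.

(** A letter in front lengthens a common prefix by one: this contracts the
    regularity constant by kappa, after adding that of q * incr. *)
Lemma transfer_prefix_regular q K u : prefix_regular kappa K u ->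
  prefix_regular kappa (kappa * (K + `|q| * C)) (transfer q u).
Proof.
move=> [u0 ur]; split=> [|a b b' an ab ab']; first exact: transfer_gt0.
rewrite /transfer mulr_sumr.
have adm j c c' : sorted e (a ++ c) -> sorted e (a ++ c') ->
    path e j (a ++ c) -> path e j (a ++ c').
  by case: a an {ab ab'} => // x a _ /= _ -> /andP[->].
rewrite [leLHS](eq_bigl (fun j => path e j (a ++ b'))); last first.
  by move=> j; apply/idP/idP; apply: adm.
apply: ler_sum => j jb'; have jb := adm j _ _ ab' ab jb'.
rewrite mulrCA; have := ur (j :: a) b b' isT jb jb'.
have := scaled_incr_regular q (a := j :: a) isT jb jb'.
rewrite /= exprS => h1 h2.
apply: (@le_trans _ _
  (expR (q * incr (j :: a ++ b') + `|q| * C * (kappa * kappa ^+ size a))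
   * (expR (K * (kappa * kappa ^+ size a)) * u (j :: a ++ b')))).
  by apply: ler_pM; rewrite ?expR_ge0 ?ler_expR // ltW ?u0.
rewrite mulrA -expRD [leRHS]mulrA -expRD le_eqVlt; apply/orP; left.
by apply/eqP; congr (expR _ * _); ring.
Qed.

Lemma transfer_le q u G : 0 <= G ->
  (forall w, w != [::] -> sorted e w -> u w <= G) ->
  forall w, sorted e w -> transfer q u w <= #|T|%:R * expR (`|q| * B) * G.
Proof.
move=> G0 uG w sw.
apply: (@le_trans _ _ (\sum_(j | path e j w) expR (`|q| * B) * G)).
  apply: ler_sum => j jw; apply: (@le_trans _ _ (expR (q * incr (j :: w)) * G)).
    by rewrite ler_wpM2l ?expR_ge0 ?uG.
  by rewrite ler_wpM2r // ler_expR scaled_incr_le.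
rewrite big_mkcond -mulrA mulr_natl -sumr_const; apply: ler_sum => j _.
by case: ifP => // _; rewrite mulr_ge0 ?expR_ge0.
Qed.

Lemma iter_transfer_le q u G n : 0 <= G ->
  (forall w, w != [::] -> sorted e w -> u w <= G) ->
  forall w, sorted e w ->
    iter n.+1 (transfer q) u w <= (#|T|%:R * expR (`|q| * B)) ^+ n.+1 * G.
Proof.
move=> G0 uG; elim: n => [|n IH] w sw; first by rewrite expr1; apply: transfer_le.
rewrite iterS exprS -mulrA; apply: transfer_le => // [|v _ sv]; last exact: IH.
by rewrite mulr_ge0 ?exprn_ge0 ?mulr_ge0 ?expR_ge0.
Qed.

Lemma iter_transfer_ge q u a : (forall w, sorted e w -> 0 < u w) ->
  forall w, sorted e (a ++ w) ->
    expR (- (`|q| * B)) ^+ size a * u (a ++ w) <= iter (size a) (transfer q) u w.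
Proof.
elim: a u => [|j a IH] u u0 w; first by rewrite expr0 mul1r.
move=> saw; have sw : sorted e (a ++ w) by exact: (path_sorted saw).
rewrite iterSr; apply: le_trans (IH _ (transfer_gt0 q u0) w sw).
rewrite exprSr -mulrA ler_wpM2l ?exprn_ge0 ?expR_ge0 //.
rewrite /transfer (bigD1 j) //=; apply: ler_wpDr.
  by apply: sumr_ge0 => i /andP[iw _]; rewrite mulr_ge0 ?expR_ge0 // ltW ?u0.
apply: ler_wpM2r; first by rewrite ltW ?u0.
by rewrite ler_expR scaled_incr_ge.
Qed.

(** The value comes from [iter_transfer_mixing]: at most #|T|^p words, two
    Birkhoff sums of length p, and one comparison of values of u. *)
Definition mixing_const (q K : R) : R :=
  (#|T|%:R * expR (`|q| * B)) ^+ p * (expR K * expR (`|q| * B) ^+ p).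

Lemma mixing_const_ge1 q K : 0 <= K -> 1 <= mixing_const q K.
Proof.
move=> K0; have E1 : 1 <= expR (`|q| * B) by rewrite -expR0 ler_expR mulr_ge0.
have T1 : 1 <= #|T|%:R :> R by rewrite ler1n.
rewrite /mixing_const mulr_ege1 ?exprn_ege1 ?mulr_ege1 //.
  by rewrite -expR0 ler_expR.
exact: exprn_ege1.
Qed.

(** Each word that contributes to the value at w' has a counterpart with the
    same first letter in front of w, by mixing; the values of u at the two words
    are comparable because they share that letter. *)
Lemma iter_transfer_mixing q K u : 0 <= K -> prefix_regular kappa K u ->
  forall w w', sorted e w -> sorted e w' ->
  iter p (transfer q) u w' <= mixing_const q K * iter p (transfer q) u w.
Proof.
move=> K0 [u0 ur] w w' sw sw'.
have I0 : 0 <= iter p (transfer q) u w by rewrite ltW // iter_transfer_gt0.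
have pE : p = p.-1.+1 by rewrite prednK.
rewrite /mixing_const -mulrA [in leLHS]pE [in X in X * _]pE.
apply: iter_transfer_le => // [|v vn sv].
  by rewrite !mulr_ge0 ?exprn_ge0 ?expR_ge0.
case: v vn sv => // i v _ sv; have [[|j a] [// sza sa [ji]]] := mixing i sw.
have := iter_transfer_ge q u0 sa; rewrite sza ji => h; rewrite ji in sa.
have h2 : u (i :: v) <= expR K * u (i :: a ++ w).
  apply: (le_trans (ur [:: i] v (a ++ w) isT sv sa)).
  apply: ler_wpM2r; first by rewrite ltW ?u0.
  by rewrite ler_expR /= expr1 ler_piMr // ltW.
apply: (le_trans h2); rewrite -mulrA ler_wpM2l ?expR_ge0 //.
move: h; rewrite expRN exprVn mulrC ler_pdivrMr ?exprn_gt0 ?expR_gt0 //.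
by rewrite mulrC.
Qed.

(** * Contraction of the ratio of two iterates *)

(** Subtracting a small multiple of a regular function spoils the regularity
    only a little; the room between K - 1 and K absorbs it. *)
Lemma prefix_regularB K c u h : 1 <= K ->
  prefix_regular kappa (K - 1) u -> prefix_regular kappa (K - 1) h -> 0 <= c ->
  (forall w, sorted e w -> c * h w <= (2 * K * expR K)^-1 * u w) ->
  prefix_regular kappa K (fun w => u w - c * h w).
Proof.
move=> K1 [u0 ur] [h0 hr] c0 chu.
have g0 : 0 < 2 * K * expR K by rewrite mulr_gt0 ?expR_gt0 //; lra.
split=> [w sw|a b b' an ab ab'].
  rewrite subr_gt0; apply: (le_lt_trans (chu w sw)).
  rewrite gtr_pMl ?u0 // invf_lt1 //.
  have : 1 < expR K by rewrite expR_gt1; lra.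
  move: (expR K) => E E1; nra.
set om := kappa ^+ size a.
have om01 : 0 <= om <= 1 by rewrite /om exprn_ge0 ?exprn_ile1 // ltW.
have gap := expR_gap K1 om01.
have E12 : expR ((K - 1) * om) <= expR (K * om).
  by rewrite ler_expR ler_wpM2r //; [case/andP: om01|lra].
have := ur _ _ _ an ab ab'; have := hr _ _ _ an ab' ab; rewrite -/om.
have := chu _ ab'; rewrite [leRHS]mulrC ler_pdivlMr //.
have := expRxMexpNx_1 ((K - 1) * om); have := expR_gt0 (- ((K - 1) * om)).
have := h0 _ ab; have := h0 _ ab'; have := u0 _ ab'.
move: (u (a ++ b)) (u (a ++ b')) (h (a ++ b)) (h (a ++ b')) E12 gap g0.
move: (2 * K * expR K) (expR (K * om)) (expR ((K - 1) * om)).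
move: (expR (- ((K - 1) * om))).
move=> F G E1 E2 ux uy hx hy E12 gap g0 uy0 hy0 hx0 F0 EF chy hyx uxy.
have hF : F * hy <= hx by rewrite -(mul1r hx) -EF; nra.
have h1 : c * F * hy <= c * hx by rewrite -mulrA ler_wpM2l.
have h2 : c * hy * (E1 - F) <= c * hy * (G * (E1 - E2)).
  by rewrite ler_wpM2l // mulr_ge0 // ltW.
have h3 : c * hy * G * (E1 - E2) <= uy * (E1 - E2).
  by rewrite ler_wpM2r // subr_ge0.
nra.
Qed.

Lemma iter_transfer_prefix_regular q K n u : 0 <= K ->
  kappa * (K + `|q| * C) <= K ->
  prefix_regular kappa K u -> prefix_regular kappa K (iter n (transfer q) u).
Proof.
move=> K0 hK hu; elim: n => //= n IH.
exact: (prefix_regular_le kappa_ge0 hK (transfer_prefix_regular q IH)).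
Qed.

(** The part of L^p u that one step splits off: the first factor keeps the
    remainder regular ([prefix_regularB]), and each use of mixing to compare the
    values of u or of h at two words costs a factor [mixing_const]. *)
Definition contraction_gain (q K : R) : R :=
  (2 * K * expR K)^-1 / mixing_const q K ^+ 4.

Lemma contraction_gain_bounds q K : 1 <= K -> 0 < contraction_gain q K < 1.
Proof.
move=> K1; have D1 := @mixing_const_ge1 q K (le_trans ler01 K1).
have D4 : 1 <= mixing_const q K ^+ 4 by rewrite exprn_ege1.
have g1 : 1 < 2 * K * expR K.
  have : 1 < expR K by rewrite expR_gt1; lra.
  move: (expR K) => E E1; nra.
have gD : 1 < 2 * K * expR K * mixing_const q K ^+ 4.
  by move: (_ ^+ 4) (2 * K * expR K) D4 g1 => x y x1 y1; nra.
by rewrite /contraction_gain -invfM invr_gt0 invf_lt1 ?gD ?andbT; lra.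
Qed.

(** By mixing, L^p u and L^p h are constant up to a bounded factor, so c can be
    chosen from their values at one word. *)
Lemma contraction_step q K u h : 1 <= K -> kappa * (K + `|q| * C) <= K - 1 ->
  prefix_regular kappa K u -> prefix_regular kappa K h ->
  exists c, let r w := iter p (transfer q) u w - c * iter p (transfer q) h w in
    prefix_regular kappa K r /\ forall w, sorted e w ->
      r w <= (1 - contraction_gain q K) * iter p (transfer q) u w.
Proof.
move=> K1 hK hu hh.
have K0 : 0 <= K by lra.
have reg v : prefix_regular kappa K v ->
    prefix_regular kappa (K - 1) (iter p (transfer q) v).
  move=> hv; rewrite -(prednK p_gt0) iterS.
  apply: (prefix_regular_le kappa_ge0 hK); apply: transfer_prefix_regular.
  by apply: iter_transfer_prefix_regular => //; lra.
have mu := iter_transfer_mixing q K0 hu.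
have mh := iter_transfer_mixing q K0 hh.
have [u0 _] := reg _ hu; have [h0 _] := reg _ hh.
have := reg _ hu; have := reg _ hh; move: u0 h0 mu mh.
rewrite /contraction_gain.
move: (iter p _ u) (iter p _ h) (@mixing_const_ge1 q K K0) => {hu hh reg} u1 h1.
move: (mixing_const q K) => D D1 u0 h0 mu mh hh hu.
have g0 : 0 < (2 * K * expR K)^-1.
  by rewrite invr_gt0 mulr_gt0 ?expR_gt0 //; lra.
set g := (2 * K * expR K)^-1 in g0 *.
have D0 : 0 < D by lra.
have un := u0 [::] isT; have hn := h0 [::] isT.
have c0 : 0 <= g / D ^+ 2 * (u1 [::] / h1 [::]).
  by apply/ltW; rewrite mulr_gt0 ?divr_gt0 ?exprn_gt0.
(* Comparing both functions with their values at the empty word costs D twice. *)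
exists (g / D ^+ 2 * (u1 [::] / h1 [::])); split=> [|w sw].
  apply: prefix_regularB => // w sw.
  have := mh [::] w isT sw; have := mu w [::] sw isT; rewrite -/g => a1 a2.
  apply: (@le_trans _ _ (g / D ^+ 2 * (u1 [::] / h1 [::]) * (D * h1 [::]))).
    by rewrite ler_wpM2l.
  have -> : g / D ^+ 2 * (u1 [::] / h1 [::]) * (D * h1 [::]) = g * (u1 [::] / D).
    by field; rewrite !gt_eqF.
  by apply: ler_wpM2l; [exact: ltW|rewrite ler_pdivrMr // mulrC].
rewrite mulrBl mul1r lerB //.
have := mh w [::] sw isT; have := mu [::] w isT sw => a1 a2.
apply: (@le_trans _ _ (g / D ^+ 2 * (u1 [::] / h1 [::]) * (h1 [::] / D))).
  have -> : g / D ^+ 2 * (u1 [::] / h1 [::]) * (h1 [::] / D) = g / D ^+ 3 * u1 [::].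
    by field; rewrite !gt_eqF.
  have -> : g / D ^+ 4 * u1 w = g / D ^+ 3 * (u1 w / D).
    by field; rewrite !gt_eqF.
  apply: ler_wpM2l; first by apply/ltW; rewrite divr_gt0 ?exprn_gt0.
  by rewrite ler_pdivrMr // mulrC.
by rewrite ler_wpM2l // ler_pdivrMr // mulrC.
Qed.

(** The remainder of one step is again regular, hence the step can be repeated
    on it while the multiples of the iterates of h add up. *)
Lemma contraction q K u h Q n : 1 <= K -> kappa * (K + `|q| * C) <= K - 1 ->
  prefix_regular kappa K u -> prefix_regular kappa K h -> 
  (forall w, sorted e w -> u w <= Q * h w) ->
  exists c r, [/\ forall w, iter (n * p) (transfer q) u w =
      c * iter (n * p) (transfer q) h w + r w, prefix_regular kappa K r &
    forall w, sorted e w ->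
      r w <= (1 - contraction_gain q K) ^+ n * Q * iter (n * p) (transfer q) h w].
Proof.
move=> K1 hK hu hh uQh; elim: n => [|n [c [r [urE hr rle]]]].
  by exists 0, u; split=> // w; [rewrite mul0r add0r|rewrite expr0 mul1r; apply: uQh].
have hh' : prefix_regular kappa K (iter (n * p) (transfer q) h).
  by apply: iter_transfer_prefix_regular => //; lra.
have [c' [hr' r'le]] := contraction_step K1 hK hr hh'.
rewrite mulSn; eexists (c + c'), _; split; [|exact: hr'|] => w.
  rewrite !iterD [X in iter p _ X w](_ : _ =
    fun w => c * iter (n * p) (transfer q) h w + r w).
    by rewrite iter_transfer_lin; ring.
  exact/funext.
move=> sw; apply: (le_trans (r'le _ sw)).
have /andP[g0 g1] := contraction_gain_bounds q K1.
have g2 : 0 <= 1 - contraction_gain q K by lra.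
rewrite exprS -!mulrA ler_wpM2l // mulrA iterD -iter_transfer_scale.
exact: iter_transfer_mono.
Qed.

(** The ratio of the iterates of u and h lies in an interval that starts at c
    and shrinks exponentially.  For n between multiples of p, positivity of the
    operator carries the last bound along. *)
Lemma contraction_osc q K u h Q n :
  1 <= K -> kappa * (K + `|q| * C) <= K - 1 ->
  prefix_regular kappa K u -> prefix_regular kappa K h ->
  (forall w, sorted e w -> u w <= Q * h w) ->
  exists c, forall w, sorted e w ->
    0 <= iter n (transfer q) u w - c * iter n (transfer q) h w <=
    (1 - contraction_gain q K) ^+ (n %/ p) * Q * iter n (transfer q) h w.
Proof.
move=> K1 hK hu hh uQh.
have [c [r [urE [r0 _] rle]]] := contraction (n %/ p) K1 hK hu hh uQh.
exists c => w sw; rewrite [n in iter n](divn_eq n p) addnC !iterD.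
rewrite [X in iter _ _ X w - _](_ : _ =
  fun w => c * iter (n %/ p * p) (transfer q) h w + r w).
  rewrite iter_transfer_lin addrAC subrr add0r; apply/andP; split.
    by apply/ltW/iter_transfer_gt0.
  by rewrite -iter_transfer_scale; apply: iter_transfer_mono.
exact/funext.
Qed.

(** * Dependence of the iterates on the exponent *)

(** The fixed point of K |-> kappa (K + |q| C), the map by which the operator
    changes regularity constants; so it serves all the iterates of 1. *)
Definition weight_reg (q : R) : R := kappa * `|q| * C / (1 - kappa).

(** Large enough for [weight] times the shifted increment, and for the operator
    to lower it by 1 as [contraction_step] requires. *)
Definition drift_reg (q : R) : R := weight_reg q + C + (1 - kappa)^-1.

Lemma weight_reg_ge0 q : 0 <= weight_reg q.
Proof. by rewrite /weight_reg divr_ge0 ?mulr_ge0 // subr_ge0 ltW. Qed.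

Lemma weight_prefix_regular q n :
  prefix_regular kappa (weight_reg q) (weight q n).
Proof.
apply: iter_transfer_prefix_regular; first exact: weight_reg_ge0.
  rewrite /weight_reg le_eqVlt; apply/orP; left; apply/eqP; field.
  by rewrite subr_eq0 gt_eqF.
split=> // a b b' _ _ _; rewrite mulr1 -expR0 ler_expR.
by rewrite mulr_ge0 ?exprn_ge0 ?weight_reg_ge0.
Qed.

Lemma drift_reg_ge1 q : 1 <= drift_reg q.
Proof.
have h0 := weight_reg_ge0 q.
have k1 : 0 < 1 - kappa by rewrite subr_gt0.
have h1 : 1 <= (1 - kappa)^-1 by rewrite invf_ge1 // gerBl.
move: h0 h1; rewrite /drift_reg; move: (weight_reg q) (_^-1) C_ge0 => x y; lra.
Qed.

Lemma drift_reg_contract q :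
  kappa * (drift_reg q + `|q| * C) <= drift_reg q - 1.
Proof.
have -> : kappa * (drift_reg q + `|q| * C) = drift_reg q - 1 - C * (1 - kappa).
  by rewrite /drift_reg /weight_reg; field; rewrite subr_eq0 gt_eqF.
by rewrite gerBl mulr_ge0 // subr_ge0 ltW.
Qed.

(** The shift by B + 1 makes the increment at least 1, so that an additive
    modulus of continuity is also a multiplicative one. *)
Lemma incr_prefix_regular : prefix_regular kappa C (fun w => incr w + (B + 1)).
Proof.
split=> [w /incr_bound|a b b' an ab ab']; first by rewrite ler_norml; lra.
have := incr_regular an ab ab'; have := incr_bound ab'; rewrite ler_norml.
have := expR_ge1Dx (C * kappa ^+ size a).
have : 0 <= C * kappa ^+ size a by rewrite mulr_ge0 ?exprn_ge0.
by move: (C * _) => x; move: (expR x) (incr _) (incr _) => E y z *; nra.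
Qed.

(** Decay of correlations: the mean of the increment at the letter that is n
    places before w depends on w only up to an exponentially small amount. *)
Lemma average_osc q j n : exists c, forall w, sorted e w ->
  0 <= iter n (transfer q) (fun x => weight q j x * incr x) w / weight q (n + j) w - c
    <= (1 - contraction_gain q (drift_reg q)) ^+ (n %/ p) * (2 * B + 1).
Proof.
have hh : prefix_regular kappa (drift_reg q) (weight q j).
  apply: prefix_regular_le (weight_prefix_regular q j) => //.
  have : 0 <= (1 - kappa)^-1 by rewrite invr_ge0 subr_ge0 ltW.
  by have := C_ge0; rewrite /drift_reg; lra.
have hu : prefix_regular kappa (drift_reg q)
    (fun w => weight q j w * (incr w + (B + 1))).
  apply: prefix_regular_le
    (prefix_regularM (weight_prefix_regular q j) incr_prefix_regular) => //.
  have : 0 <= (1 - kappa)^-1 by rewrite invr_ge0 subr_ge0 ltW.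
  by have := C_ge0; rewrite /drift_reg; lra.
have uQh w : sorted e w ->
    weight q j w * (incr w + (B + 1)) <= (2 * B + 1) * weight q j w.
  move=> sw; rewrite mulrC; apply: ler_wpM2r; first exact/ltW/weight_gt0.
  by have := incr_bound sw; rewrite ler_norml; lra.
have [c hc] := contraction_osc n (drift_reg_ge1 q) (drift_reg_contract q) hu hh uQh.
exists (c - (B + 1)) => w sw; have := hc w sw.
have -> : iter n (transfer q) (fun w => weight q j w * (incr w + (B + 1))) w =
    (B + 1) * weight q (n + j) w +
    iter n (transfer q) (fun x => weight q j x * incr x) w.
  rewrite /weight iterD -/(weight q j) -iter_transfer_lin.
  by congr (iter n _ _ w); apply/funext => x; ring.
rewrite -iterD -/(weight q (n + j)); have := weight_gt0 q (n + j) sw.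
move: (weight q (n + j) w) (iter n _ _ _) (_ ^+ _) => h x r h0 /andP[h1 h2].
have -> : x / h - (c - (B + 1)) = ((B + 1) * h + x - c * h) / h.
  by field; rewrite gt_eqF.
by apply/andP; split; [rewrite divr_ge0 // ltW|rewrite ler_pdivrMr].
Qed.

(** Shifting the index by p multiplies the sum by rho up to its first p terms,
    which are all 1. *)
Lemma sum_expr_divn (rho : R) n : 0 <= rho < 1 ->
  \sum_(i < n) rho ^+ (i %/ p) <= p%:R / (1 - rho).
Proof.
move=> /andP[r0 r1]; rewrite ler_pdivlMr ?subr_gt0 //.
set s := \sum_(i < n) _.
have h1 : s <= \sum_(i < p + n) rho ^+ (i %/ p).
  rewrite addnC big_split_ord /= lerDl; apply: sumr_ge0 => i _.
  exact: exprn_ge0.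
have h2 : \sum_(i < p + n) rho ^+ (i %/ p) <= p%:R + rho * s.
  rewrite big_split_ord /=; apply: lerD.
    apply: (@le_trans _ _ (\sum_(i < p) 1)); last by rewrite sumr_const card_ord.
    by apply: ler_sum => i _; rewrite divn_small.
  rewrite mulr_sumr; apply: ler_sum => i _.
  by rewrite -{1}(mul1n p) divnMDl // add1n exprS.
by have := le_trans h1 h2; rewrite mulrBr; lra.
Qed.

(** The mean of the Birkhoff sum S (J ++ w) - S w over the words J of length n,
    for the weights whose sum is [weight q n w]: the j-th term is the mean of
    the increment of the (j+1)-st letter of J. *)
Definition drift (q : R) (n : nat) (w : seq T) : R :=
  (\sum_(j < n) iter (n - j) (transfer q) (fun x => weight q j x * incr x) w)
    / weight q n w.

Definition drift_width (q : R) : R :=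
  p%:R / contraction_gain q (drift_reg q) * (2 * B + 1).

Lemma drift_osc q n w w' : sorted e w -> sorted e w' ->
  drift q n w - drift q n w' <= drift_width q.
Proof.
move=> sw sw'; rewrite /drift !mulr_suml -sumrB.
have /andP[g0 g1] := contraction_gain_bounds q (drift_reg_ge1 q).
set rho := 1 - contraction_gain q (drift_reg q).
have r01 : 0 <= rho < 1 by rewrite /rho; lra.
apply: (@le_trans _ _ (\sum_(j < n) rho ^+ ((n - j) %/ p) * (2 * B + 1))).
  apply: ler_sum => j _; have [c hc] := average_osc q j (n - j).
  have := hc w sw; have := hc w' sw'; rewrite subnK -/rho; last exact: ltnW.
  by lra.
rewrite -mulr_suml /drift_width ler_wpM2r ?addr_ge0 ?mulr_ge0 //.
have -> : contraction_gain q (drift_reg q) = 1 - rho by rewrite /rho; ring.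
apply: le_trans (sum_expr_divn n r01); rewrite (reindex_inj rev_ord_inj) /=.
apply: ler_sum => i _; rewrite subKn //.
have /andP[r0 r1] := r01.
by apply: ler_wiXn2l => //; [exact: ltW|exact/leq_div2r/leqnSn].
Qed.

(** The recursion of conditional means: the drift at n + 1 averages the drift at
    n plus the increment of the new letter. *)
Lemma drift_transfer q n w : sorted e w ->
  transfer q (fun x => weight q n x * (incr x + drift q n x)) w =
  weight q n.+1 w * drift q n.+1 w.
Proof.
move=> sw; rewrite /drift mulrCA divff ?mulr1; last by rewrite gt_eqF ?weight_gt0.
rewrite big_ord_recr /= subSnn /= -/(drift q n).
transitivity (transfer q (fun x => 1 * (\sum_(j < n)
    iter (n - j) (transfer q) (fun x => weight q j x * incr x) x)
    + weight q n x * incr x) w).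
  apply: eq_bigr => j jw; congr (_ * _); rewrite mul1r mulrDr addrC; congr (_ + _).
  by rewrite /drift mulrCA divff ?mulr1 // gt_eqF ?weight_gt0.
rewrite transfer_lin mul1r; congr (_ + _).
transitivity (\sum_(i | path e i w) \sum_(j < n) expR (q * incr (i :: w)) *
    iter (n - j) (transfer q) (fun x => weight q j x * incr x) (i :: w)).
  by apply: eq_bigr => i _; rewrite mulr_sumr.
by rewrite exchange_big /=; apply: eq_bigr => i _; rewrite subSn // ltnW.
Qed.

Lemma transfer_shift q t u w :
  transfer (q + t) u w = transfer q (fun x => expR (t * incr x) * u x) w.
Proof. by apply: eq_bigr => j _; rewrite mulrDl expRD mulrA. Qed.

(** The drift at n + 1 is a mean of the quantities incr + drift, which vary by
    at most 2B plus the oscillation of the drift. *)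
Lemma incr_drift_near q n w j : sorted e w -> path e j w ->
  `|incr (j :: w) + drift q n (j :: w) - drift q n.+1 w| <= 2 * B + drift_width q.
Proof.
move=> sw jw.
pose a i := expR (q * incr (i :: w)) * weight q n (i :: w).
pose X i := incr (i :: w) + drift q n (i :: w).
have XX i k : path e i w -> path e k w -> X i - X k <= 2 * B + drift_width q.
  move=> iw kw; have := @drift_osc q n (i :: w) (k :: w) iw kw.
  have := @incr_bound (i :: w) iw; have := @incr_bound (k :: w) kw.
  by rewrite !ler_norml /X; lra.
have a0 i : path e i w -> 0 <= a i.
  by move=> iw; rewrite mulr_ge0 ?expR_ge0 // ltW ?weight_gt0.
have A0 : 0 < \sum_(i | path e i w) a i by exact: (weight_gt0 q n.+1 sw).
have Am : (\sum_(i | path e i w) a i) * drift q n.+1 w = \sum_(i | path e i w) a i * X i.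
  by rewrite -/(weight q n.+1 w) -drift_transfer //; apply: eq_bigr => i _; rewrite mulrA.
rewrite -/(X j) ler_norml; apply/andP; split.
  rewrite lerNl opprB -(ler_pM2l A0) mulrBr Am !mulr_suml -sumrB.
  by apply: ler_sum => i iw; rewrite -mulrBr ler_wpM2l ?a0 ?XX.
rewrite -(ler_pM2l A0) mulrBr Am !mulr_suml -sumrB.
by apply: ler_sum => i iw; rewrite -mulrBr ler_wpM2l ?a0 ?XX.
Qed.

(** Induction on n: the factor exp(t d_n) is absorbed in the operator at q + t,
    and averaging it costs a factor exp(O(t^2)) per letter, uniformly in n,
    thanks to the uniform bound on the oscillation of d_n. *)
Lemma weight_shift q t n w : `|t| * (2 * B + drift_width q) <= 2^-1 ->
  sorted e w ->
  weight q n w * expR (t * drift q n w) <= weight (q + t) n w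
    <= weight q n w *
       expR (t * drift q n w + 2 * t ^+ 2 * (2 * B + drift_width q) ^+ 2 * n%:R).
Proof.
move=> tV; set E := 2 * t ^+ 2 * _ ^+ 2.
elim: n w => [|n IH] w sw.
  by rewrite /drift big_ord0 mul0r mulr0 mulr0 add0r expR0 mulr1 /= lexx.
pose a i := expR (q * incr (i :: w)) * weight q n (i :: w).
pose X i := incr (i :: w) + drift q n (i :: w).
have a0 i : path e i w -> 0 <= a i.
  by move=> iw; rewrite mulr_ge0 ?expR_ge0 // ltW ?weight_gt0.
have am : \sum_(i | path e i w) a i * X i = (\sum_(i | path e i w) a i) * drift q n.+1 w.
  rewrite [RHS](_ : _ = weight q n.+1 w * drift q n.+1 w) // -drift_transfer //.
  by apply: eq_bigr => i _; rewrite mulrA.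
have /andP[lo hi] := exponential_average a0 am (fun i => @incr_drift_near q n w i sw) tV.
have -> : weight (q + t) n.+1 w =
    transfer q (fun x => expR (t * incr x) * weight (q + t) n x) w.
  by rewrite -transfer_shift.
apply/andP; split.
  apply: (le_trans lo); apply: ler_sum => i iw.
  have /andP[h _] := IH (i :: w) iw.
  rewrite /a /X -mulrA ler_wpM2l ?expR_ge0 // mulrDr expRD mulrCA.
  by rewrite ler_wpM2l ?expR_ge0.
have -> : t * drift q n.+1 w + E * n.+1%:R = E * n%:R + (t * drift q n.+1 w + E).
  by rewrite -natr1; ring.
rewrite expRD mulrCA.
apply: le_trans (ler_wpM2l (expR_ge0 _) hi); rewrite mulr_sumr; apply: ler_sum => i iw.
have /andP[_ h] := IH (i :: w) iw.
have -> : expR (E * n%:R) * (a i * expR (t * X i)) =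
    expR (q * incr (i :: w)) * (expR (t * incr (i :: w)) *
      (weight q n (i :: w) * expR (t * drift q n (i :: w) + E * n%:R))).
  by rewrite /a /X (mulrDr t) !expRD; ring.
by apply: ler_wpM2l; rewrite ?expR_ge0 // ler_wpM2l ?expR_ge0.
Qed.

(** For n at least p the function [weight q n] is constant up to a bounded
    factor, so it can be pulled out of the k remaining iterations. *)
Lemma weight_quasi_multiplicative q n k : (p <= n)%N ->
  (mixing_const q (weight_reg q))^-1 * (weight q k [::] * weight q n [::])
    <= weight q (k + n) [::]
    <= mixing_const q (weight_reg q) * (weight q k [::] * weight q n [::]).
Proof.
move=> pn; set D := mixing_const q _.
have D0 : 0 < D by apply: lt_le_trans (mixing_const_ge1 _ (weight_reg_ge0 _)).
have comp w w' : sorted e w -> sorted e w' -> weight q n w' <= D * weight q n w.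
  rewrite /weight -(subnKC pn) iterD -/(weight q (n - p)) => sw sw'.
  apply: iter_transfer_mixing => //; first exact: weight_reg_ge0.
  exact: weight_prefix_regular.
have kE c : iter k (transfer q) (fun=> c) [::] = c * weight q k [::].
  rewrite /weight -iter_transfer_scale; congr (iter k _ _ _).
  by apply/funext => x; rewrite mulr1.
rewrite [weight q (k + n)]/weight iterD -/(weight q n); apply/andP; split.
  rewrite mulrCA [X in X <= _]mulrC -kE; apply: iter_transfer_mono => // w sw.
  by rewrite mulrC ler_pdivrMr // mulrC comp.
rewrite mulrCA [X in _ <= X]mulrC -kE; apply: iter_transfer_mono => // w sw.
exact: comp.
Qed.

Lemma drift_width_ge0 q : 0 <= drift_width q.
Proof. by have := @drift_osc q 0 [::] [::] isT isT; rewrite subrr. Qed.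

Lemma ln_weight_additive q k n : (p <= n)%N ->
  `|ln (weight q (k + n) [::]) - ln (weight q k [::]) - ln (weight q n [::])|
    <= ln (mixing_const q (weight_reg q)).
Proof.
move=> pn; have /andP[] := weight_quasi_multiplicative q k pn.
have D1 := mixing_const_ge1 q (weight_reg_ge0 q).
have := @weight_gt0 q (k + n) [::] isT; have := @weight_gt0 q k [::] isT.
have := @weight_gt0 q n [::] isT; move: (mixing_const _ _) D1 => D D1.
move: (weight q (k + n) _) (weight q k _) (weight q n _) => x y z z0 y0 x0.
have D0 : 0 < D by lra.
rewrite -ler_ln ?posrE ?mulr_gt0 ?invr_gt0 // !lnM ?posrE ?mulr_gt0 ?invr_gt0 //.
rewrite lnV ?posrE // => h1.
rewrite -ler_ln ?posrE ?mulr_gt0 // !lnM ?posrE ?mulr_gt0 // => h2.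
by rewrite ler_norml; lra.
Qed.

(** The bounded perturbation z makes room for suprema over cylinders in place of
    values at one point. *)
Theorem growth_rate_derivable (z : R -> nat -> R) q :
  (forall s, exists c, forall n, (0 < n)%N ->
     `|z s n - ln (weight s n [::])| <= c) ->
  derivable (fun s => lim ((fun n => n%:R^-1 * z s n) @ \oo)) q 1.
Proof.
move=> hz; set V := 2 * B + drift_width q.
have V0 : 0 <= V by rewrite addr_ge0 ?drift_width_ge0 ?mulr_ge0.
have V1 : 0 < 2 * (V + 1) by lra.
apply: (@derivable_lim _ _ (fun n => drift q n [::]) _ (2 * V ^+ 2) (2 * (V + 1))^-1).
- by rewrite invr_gt0.
- by rewrite mulr_ge0 ?exprn_ge0.
- move=> s; have [c hc] := hz s.
  apply: (@cvg_nearly_additive _ _ (ln (mixing_const s (weight_reg s)) + 3 * c) p).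
  move=> k n k0 pn; have n0 : (0 < n)%N by exact: leq_trans pn.
  have := hc _ k0; have := hc _ n0; have := hc _ (ltn_addl k n0).
  have := ln_weight_additive s k pn.
  move: (ln (weight s (k + n) _)) (ln (weight s k _)) (ln (weight s n _))
    (ln (mixing_const _ _)).
  by move=> x1 x2 x3 D; rewrite !ler_norml; lra.
- move=> t td; have [c hc] := hz q; have [c' hc'] := hz (q + t).
  exists (c + c') => n n0.
  have tV : `|t| * V <= 2^-1.
    apply: (@le_trans _ _ ((2 * (V + 1))^-1 * V)); first by rewrite ler_wpM2r.
    by rewrite mulrC ler_pdivrMr //; lra.
  have /andP[] := @weight_shift q t n [::] tV isT.
  have w0 := @weight_gt0 q n [::] isT; have w1 := @weight_gt0 (q + t) n [::] isT.
  rewrite -ler_ln ?posrE ?mulr_gt0 ?expR_gt0 // lnM ?posrE ?expR_gt0 // expRK => h1.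
  rewrite -ler_ln ?posrE ?mulr_gt0 ?expR_gt0 // lnM ?posrE ?expR_gt0 // expRK => h2.
  have := hc n n0; have := hc' n n0; move: h1 h2; rewrite -/V.
  have -> : 2 * V ^+ 2 * t ^+ 2 * n%:R = 2 * t ^+ 2 * V ^+ 2 * n%:R by ring.
  have : 0 <= 2 * t ^+ 2 * V ^+ 2 * n%:R.
    by rewrite mulr_ge0 // mulr_ge0 ?sqr_ge0 // mulr_ge0 ?sqr_ge0.
  move: (ln (weight q n _)) (ln (weight (q + t) n _))
    (2 * t ^+ 2 * _ * _) (t * drift _ _ _).
  by move=> x y e1 e2; rewrite !ler_norml; lra.
Qed.

End TransferOperator.

(** * Projective contraction by positive matrices *)

Section ProjectiveContraction.

Variables (R : realType) (d : nat).
Implicit Types (v w : 'I_d -> R) (P Q : 'M[R]_d).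

(** The ratios v_i / w_i differ from each other by a factor of at most 1 + s,
    i.e., v and w are at distance at most ln (1 + s) in Hilbert's projective
    metric.  In terms of s the contraction below is multiplication by a
    constant. *)
Definition proj_close (s : R) v w : Prop :=
  forall i k, v i * w k <= (1 + s) * (v k * w i).

Definition mxapply P v (i : 'I_d) : R := \sum_j P i j * v j.

Lemma mxapply_gt0 P v : positive_mx P -> (forall i, 0 < v i) ->
  forall i, 0 < mxapply P v i.
Proof.
move=> P0 v0 i; rewrite /mxapply (bigD1 i) //=; apply: ltr_pwDl.
  by rewrite mulr_gt0.
by apply: sumr_ge0 => j _; rewrite mulr_ge0 // ltW.
Qed.

(** Birkhoff's contraction.  The claim compares two double sums over (j, l) with
    coefficients c j l = P i j P k l of v_j w_l and of v_l w_j.  Antisymmetrize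
    in (j, l): the differences of the coefficients lose the proportion
    (a / b)^2, because all 2 x 2 products of entries are comparable. *)
Lemma proj_close_mxapply (a b s : R) P v w : 0 < a -> 0 <= s ->
  (forall i j, a <= P i j <= b) -> (forall i, 0 < v i) -> (forall i, 0 < w i) ->
  proj_close s v w ->
  proj_close ((1 - (a / b) ^+ 2) * s) (mxapply P v) (mxapply P w).
Proof.
move=> a0 s0 Pab v0 w0 vw i k.
have b0 : 0 < b.
  have /andP[h1 h2] := Pab i i; exact: lt_le_trans (lt_le_trans a0 h1) h2.
set r := (a / b) ^+ 2.
have Plo x y : a <= P x y by have /andP[] := Pab x y.
have Phi x y : P x y <= b by have /andP[] := Pab x y.
have P0 x y : 0 < P x y by exact: lt_le_trans (Plo x y).
have rP x y x' y' : r * (P x y * P x' y') <= P x y' * P x' y.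
  apply: (@le_trans _ _ (a * a)); last by apply: ler_pM => //; exact: ltW.
  have -> : a * a = r * (b * b) by rewrite /r; field; rewrite gt_eqF.
  by rewrite ler_wpM2l ?sqr_ge0 //; apply: ler_pM => //; exact: ltW.
pose c j l := P i j * P k l; pose X j l := v j * w l.
have E1 : mxapply P v i * mxapply P w k = \sum_j \sum_l c j l * X j l.
  rewrite /mxapply mulr_suml; apply: eq_bigr => j _; rewrite mulr_sumr.
  by apply: eq_bigr => l _; rewrite /c /X mulrACA.
have E2 : mxapply P v k * mxapply P w i = \sum_j \sum_l c j l * X l j.
  rewrite mulrC /mxapply mulr_suml; apply: eq_bigr => j _; rewrite mulr_sumr.
  by apply: eq_bigr => l _; rewrite /c /X mulrACA (mulrC (w j)).
have sw (f : 'I_d -> 'I_d -> R) : \sum_j \sum_l f l j = \sum_j \sum_l f j l.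
  by rewrite exchange_big.
have pt j l : (c j l - c l j) * (X j l - X l j) <=
    (1 - r) * s * (c j l * X l j + c l j * X j l).
  have c0 x y : 0 < c x y by rewrite mulr_gt0.
  have X0 x y : 0 < X x y by rewrite mulr_gt0.
  have Xs x y : X x y <= (1 + s) * X y x by exact: vw.
  have cr x y : r * c x y <= c y x by exact: rP.
  have r1 : r <= 1.
    have := rP i j i j; rewrite -[leRHS]mul1r ler_pM2r ?mulr_gt0 //.
  have one x y : X y x <= X x y -> (c x y - c y x) * (X x y - X y x) <=
      (1 - r) * s * (c x y * X y x).
    move=> hX; apply: (@le_trans _ _ ((1 - r) * c x y * (X x y - X y x))).
      by rewrite ler_wpM2r ?subr_ge0 // mulrBl mul1r lerB // cr.
    have -> : (1 - r) * s * (c x y * X y x) = (1 - r) * c x y * (s * X y x) by ring.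
    apply: ler_wpM2l; first by rewrite mulr_ge0 ?subr_ge0 // ltW.
    by have := Xs x y; rewrite mulrDl mul1r; lra.
  have nn x y : 0 <= (1 - r) * s * (c x y * X y x).
    by rewrite mulr_ge0 ?(mulr_ge0, subr_ge0) // ltW ?mulr_gt0.
  rewrite [leRHS]mulrDr; case: (leP (X l j) (X j l)) => hX.
    by apply: (le_trans (one _ _ hX)); rewrite lerDl.
  have -> : (c j l - c l j) * (X j l - X l j) = (c l j - c j l) * (X l j - X j l) by ring.
  by apply: (le_trans (one _ _ (ltW hX))); rewrite lerDr.
have : \sum_j \sum_l (c j l - c l j) * (X j l - X l j) <=
    \sum_j \sum_l (1 - r) * s * (c j l * X l j + c l j * X j l).
  by apply: ler_sum => j _; apply: ler_sum => l _; exact: pt.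
have -> : \sum_j \sum_l (c j l - c l j) * (X j l - X l j) =
    2 * (\sum_j \sum_l c j l * X j l - \sum_j \sum_l c j l * X l j).
  transitivity (\sum_j \sum_l c j l * X j l + \sum_j \sum_l c l j * X l j
     - (\sum_j \sum_l c j l * X l j + \sum_j \sum_l c l j * X j l)).
    rewrite -!big_split -sumrB /=; apply: eq_bigr => j _.
    by rewrite -!big_split -sumrB /=; apply: eq_bigr => l _; ring.
  by rewrite (sw (fun j l => c j l * X j l)) (sw (fun j l => c j l * X l j)); ring.
have -> : \sum_j \sum_l (1 - r) * s * (c j l * X l j + c l j * X j l) =
    2 * ((1 - r) * s * \sum_j \sum_l c j l * X l j).
  transitivity ((1 - r) * s *
      (\sum_j \sum_l c j l * X l j + \sum_j \sum_l c l j * X j l)).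
    rewrite -!big_split /= mulr_sumr; apply: eq_bigr => j _.
    by rewrite -!big_split /= mulr_sumr.
  by rewrite (sw (fun j l => c j l * X l j)); ring.
by rewrite ler_pM2l // lerBlDl E1 E2 => h; rewrite [leRHS]mulrDl mul1r.
Qed.
End ProjectiveContraction.

(** * Products of positive matrices along the shift *)

Definition agree (I : Type) (n : nat) (x y : nat -> I) : Prop :=
  forall k, (k < n)%N -> x k = y k.

Lemma agree_shift (I : Type) n (x y : nat -> I) :
  agree n.+1 x y -> agree n (Defs.shift x) (Defs.shift y).
Proof. by move=> xy k kn; apply: xy. Qed.

Lemma subshift_shift (m : nat) (A : 'M[nat]_m) x :
  subshift A x -> subshift A (Defs.shift x).
Proof. by move=> Ax k; apply: Ax. Qed.

Section CocycleEstimates.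

Variables (R : realType) (m d : nat) (A : 'M[nat]_m).
Variables (M : (nat -> 'I_m) -> 'M[R]_d) (a b c theta : R).
Hypothesis d_gt0 : (0 < d)%N.
Hypothesis a_gt0 : 0 < a.
Hypothesis M_bounds : forall x, subshift A x -> forall i j, a <= M x i j <= b.
Hypothesis c_ge0 : 0 <= c.
Hypothesis theta_gt0 : 0 < theta.
Hypothesis theta_lt1 : theta < 1.
Hypothesis M_regular : forall n x y, subshift A x -> subshift A y ->
  agree n x y -> forall i j, M x i j <= (1 + c * theta ^+ n) * M y i j.

Definition row_sums (n : nat) (x : nat -> 'I_m) (i : 'I_d) : R :=
  \sum_j cocycle M n x i j.

Lemma sum_norm_row_sums n x : sum_norm (cocycle M n x) = \sum_i row_sums n x i.
Proof. by []. Qed.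

Lemma row_sums0 x i : row_sums 0 x i = 1.
Proof.
rewrite /row_sums /cocycle big_ord0 (bigD1 i) //= big1 ?addr0 => [|j ji].
  by rewrite mxE eqxx.
by rewrite mxE eq_sym (negbTE ji).
Qed.

Lemma row_sumsS n x i :
  row_sums n.+1 x i = mxapply (M x) (row_sums n (Defs.shift x)) i.
Proof.
have -> : row_sums n.+1 x i = \sum_j (M x *m cocycle M n (Defs.shift x)) i j.
  apply: eq_bigr => j _; rewrite /cocycle big_ord_recl.
  congr ((_ *m _) _ _); apply: eq_bigr => k _.
  by rewrite -iterSr.
rewrite /mxapply; under eq_bigr do rewrite mxE.
by rewrite exchange_big /=; apply: eq_bigr => k _; rewrite mulr_sumr.
Qed.

Lemma M_gt0 x : subshift A x -> positive_mx (M x).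
Proof. by move=> /M_bounds h i j; have /andP[+ _] := h i j; apply: lt_le_trans. Qed.

Lemma row_sums_gt0 n x : subshift A x -> forall i, 0 < row_sums n x i.
Proof.
elim: n x => [|n IH] x Ax i; first by rewrite row_sums0.
rewrite row_sumsS; apply: mxapply_gt0; first exact: M_gt0.
exact/IH/subshift_shift.
Qed.

Lemma sum_norm_gt0 n x : subshift A x -> 0 < sum_norm (cocycle M n x).
Proof.
move=> Ax; rewrite sum_norm_row_sums (bigD1 (Ordinal d_gt0)) //=.
apply: ltr_pwDl; first exact: row_sums_gt0.
by apply: sumr_ge0 => i _; apply/ltW/row_sums_gt0.
Qed.

Lemma row_sums_bounds n x i : subshift A x ->
  a * sum_norm (cocycle M n (Defs.shift x)) <= row_sums n.+1 x i
    <= b * sum_norm (cocycle M n (Defs.shift x)).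
Proof.
move=> Ax; rewrite row_sumsS sum_norm_row_sums /mxapply !mulr_sumr.
have v0 j : 0 <= row_sums n (Defs.shift x) j by apply/ltW/row_sums_gt0/subshift_shift.
by apply/andP; split; apply: ler_sum => j _; rewrite ler_wpM2r //;
  have /andP[] := M_bounds Ax i j.
Qed.

Lemma sum_norm_bounds n x : subshift A x ->
  d%:R * a * sum_norm (cocycle M n (Defs.shift x)) <= sum_norm (cocycle M n.+1 x)
    <= d%:R * b * sum_norm (cocycle M n (Defs.shift x)).
Proof.
move=> Ax; rewrite -!mulrA [sum_norm (cocycle M n.+1 x)]sum_norm_row_sums.
have cst (r : R) : d%:R * r = \sum_(i < d) r by rewrite sumr_const card_ord mulr_natl.
by rewrite !cst; apply/andP; split; apply: ler_sum => i _;
  have /andP[] := row_sums_bounds n i Ax.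
Qed.

(** Entrywise comparison of the factors; the k-th factors agree on n - k letters,
    so the errors form a geometric series, summed in the exponent. *)
Lemma row_sums_distortion n x y : subshift A x -> subshift A y -> agree n x y ->
  forall i, row_sums n x i <=
    expR (c * ((1 - theta ^+ n) / (1 - theta))) * row_sums n y i.
Proof.
elim: n x y => [|n IH] x y Ax Ay xy i.
  by rewrite !row_sums0 mulr1 expr0 subrr mul0r mulr0 expR0.
have IHs := IH _ _ (subshift_shift Ax) (subshift_shift Ay) (agree_shift xy).
rewrite !row_sumsS /mxapply mulr_sumr; apply: ler_sum => j _.
have Mxy : M x i j <= expR (c * theta ^+ n) * M y i j.
  apply: (le_trans (M_regular Ax Ay xy i j)); apply: ler_wpM2r.
    exact/ltW/M_gt0.
  apply: le_trans (expR_ge1Dx _); rewrite lerD2l ler_wpM2l //.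
  by apply: ler_wiXn2l => //; exact: ltW.
have -> : c * ((1 - theta ^+ n.+1) / (1 - theta)) =
    c * theta ^+ n + c * ((1 - theta ^+ n) / (1 - theta)).
  by rewrite exprS; field; rewrite subr_eq0 gt_eqF.
rewrite expRD mulrACA; apply: ler_pM => //; apply/ltW; first exact: M_gt0.
exact/row_sums_gt0/subshift_shift.
Qed.

Lemma sum_norm_distortion n x y : subshift A x -> subshift A y -> agree n x y ->
  ln (sum_norm (cocycle M n x)) <= ln (sum_norm (cocycle M n y)) + c / (1 - theta).
Proof.
move=> Ax Ay xy.
have h : sum_norm (cocycle M n x) <= expR (c / (1 - theta)) * sum_norm (cocycle M n y).
  rewrite !sum_norm_row_sums mulr_sumr; apply: ler_sum => i _.
  apply: (le_trans (row_sums_distortion Ax Ay xy i)).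
  apply: ler_wpM2r; first exact/ltW/row_sums_gt0.
  rewrite ler_expR ler_wpM2l // -[leRHS]mul1r; apply: ler_wpM2r.
    by rewrite invr_ge0 subr_ge0 ltW.
  by rewrite gerBl exprn_ge0 // ltW.
move: h; rewrite -ler_ln ?posrE ?mulr_gt0 ?expR_gt0 ?sum_norm_gt0 //.
by rewrite lnM ?posrE ?expR_gt0 ?sum_norm_gt0 // expRK addrC.
Qed.

Definition gap : R := (a / b) ^+ 2.

(** All images of positive vectors under the matrices are this close. *)
Definition proj_diam : R := gap^-1 - 1.

(** The mean of 1 - gap and 1, unless theta is larger: the slack gap / 2 pays for
    the errors of size theta^n made by replacing a matrix by a nearby one. *)
Definition proj_rate : R := Num.max theta (1 - gap / 2).

Definition proj_const : R :=
  proj_diam + (2 * c + c ^+ 2) * (1 + proj_diam) * 2 / gap.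

Lemma b_gt0 x : subshift A x -> 0 < b.
Proof.
move=> Ax; have i := Ordinal d_gt0; have /andP[ai ib] := M_bounds Ax i i.
exact: lt_le_trans (le_trans ai ib).
Qed.

Lemma gap_bounds x : subshift A x -> 0 < gap <= 1.
Proof.
move=> Ax; have b0 := b_gt0 Ax; have i := Ordinal d_gt0.
have /andP[ai ib] := M_bounds Ax i i.
rewrite /gap exprn_gt0 ?divr_gt0 //= exprn_ile1 ?divr_ge0 ?(ltW b0) ?(ltW a_gt0) //.
by rewrite ler_pdivrMr // mul1r (le_trans ai).
Qed.

Lemma proj_rate_bounds x : subshift A x ->
  [/\ 0 < proj_rate, proj_rate < 1, theta <= proj_rate & 1 - gap / 2 <= proj_rate].
Proof.
move=> Ax; have /andP[g0 g1] := gap_bounds Ax.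
rewrite /proj_rate !le_max !lexx orbT lt_max theta_gt0; split=> //.
by rewrite gt_max theta_lt1 /=; lra.
Qed.

Lemma proj_diam_ge0 x : subshift A x -> 0 <= proj_diam.
Proof.
by move=> /gap_bounds/andP[g0 g1]; rewrite /proj_diam subr_ge0 invf_ge1.
Qed.

Lemma proj_const_ge x : subshift A x -> proj_diam <= proj_const.
Proof.
move=> Ax; have /andP[g0 _] := gap_bounds Ax; have s0 := proj_diam_ge0 Ax.
rewrite lerDl divr_ge0 ?(ltW g0) // mulr_ge0 // mulr_ge0 //.
  by rewrite addr_ge0 ?mulr_ge0 ?sqr_ge0.
exact: addr_ge0.
Qed.

Lemma proj_close_diam x y k k' : subshift A x -> subshift A y ->
  proj_close proj_diam (row_sums k.+1 x) (row_sums k'.+1 y).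
Proof.
move=> Ax Ay i l; have b0 := b_gt0 Ax.
have /andP[_ h1] := row_sums_bounds k i Ax.
have /andP[_ h2] := row_sums_bounds k' l Ay.
have /andP[h3 _] := row_sums_bounds k l Ax.
have /andP[h4 _] := row_sums_bounds k' i Ay.
have X0 := sum_norm_gt0 k (subshift_shift Ax).
have Y0 := sum_norm_gt0 k' (subshift_shift Ay).
move: X0 Y0 h1 h2 h3 h4.
move: (sum_norm (cocycle M k _)) (sum_norm (cocycle M k' _)).
move=> X Y X0 Y0 h1 h2 h3 h4.
apply: (@le_trans _ _ ((b * X) * (b * Y))).
  by apply: ler_pM => //; apply/ltW/row_sums_gt0.
have -> : 1 + proj_diam = (b / a) ^+ 2.
  by rewrite /proj_diam addrCA subrr addr0 /gap -exprVn invf_div.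
have -> : (b * X) * (b * Y) = (b / a) ^+ 2 * ((a * X) * (a * Y)).
  by field; rewrite gt_eqF.
rewrite ler_wpM2l ?sqr_ge0 //.
by apply: ler_pM => //; rewrite mulr_ge0 // ltW.
Qed.

(** The two points may carry products of different lengths k and k': what lies
    beyond their common beginning is forgotten exponentially fast.  One matrix
    contracts by 1 - gap, and replacing it by the matrix at the other point
    costs a factor (1 + c theta^n)^2. *)
Lemma proj_close_row_sums n x y k k' : subshift A x -> subshift A y ->
  agree n.+1 x y -> (n < k)%N -> (n < k')%N ->
  proj_close (proj_const * proj_rate ^+ n) (row_sums k x) (row_sums k' y).
Proof.
move=> Ax Ay; have /andP[g0 g1] := gap_bounds Ax.
have b0 := b_gt0 Ax.
have s0 := proj_diam_ge0 Ax; have sC := proj_const_ge Ax.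
have C0 := le_trans s0 sC; have [r0 r1 rt rg] := proj_rate_bounds Ax.
elim: n x y k k' Ax Ay => [|n IH] x y [//|k] [//|k'] Ax Ay xy nk nk'.
  rewrite expr0 mulr1 => i l; apply: (le_trans (proj_close_diam k k' Ax Ay i l)).
  apply: ler_wpM2r; last by rewrite lerD2l.
  by rewrite mulr_ge0 // ltW // row_sums_gt0.
have Ax' := subshift_shift Ax; have Ay' := subshift_shift Ay.
(* Closeness by both bounds at once: the bound that does not depend on n keeps
   the error term of the recursion free of [proj_const]. *)
have hc : exists s, [/\ 0 <= s, s <= proj_diam, s <= proj_const * proj_rate ^+ n &
    proj_close s (row_sums k (Defs.shift x)) (row_sums k' (Defs.shift y))].
  have IHc := IH _ _ _ _ Ax' Ay' (agree_shift xy) nk nk'.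
  exists (Num.min proj_diam (proj_const * proj_rate ^+ n)).
  rewrite le_min s0 mulr_ge0 ?exprn_ge0 ?(ltW r0) // !ge_min !lexx orbT.
  split=> //; case: (leP proj_diam _) => _ //.
  by case: k k' nk nk' {IHc} => [//|k] [//|k'] _ _; apply: proj_close_diam.
have [s [s_ge0 ss sr vw]] := hc.
have v0 := row_sums_gt0 k Ax'; have w0 := row_sums_gt0 k' Ay'.
have := proj_close_mxapply a_gt0 s_ge0 (M_bounds Ax) v0 w0 vw.
rewrite -/gap; set s1 := (1 - gap) * s => vw1.
set e := c * theta ^+ n.+2.
have e0 : 0 <= e by rewrite mulr_ge0 ?exprn_ge0 // ltW.
have Pw l : mxapply (M x) (row_sums k' (Defs.shift y)) l <= (1 + e) * row_sums k'.+1 y l.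
  rewrite row_sumsS /mxapply mulr_sumr; apply: ler_sum => j _; rewrite mulrA.
  by apply: ler_wpM2r; [exact: ltW|exact: M_regular].
have Pw' l : row_sums k'.+1 y l <= (1 + e) * mxapply (M x) (row_sums k' (Defs.shift y)) l.
  rewrite row_sumsS /mxapply mulr_sumr; apply: ler_sum => j _; rewrite mulrA.
  apply: ler_wpM2r; [exact: ltW|apply: M_regular => // z zn].
  by rewrite xy.
have s1_ge0 : 0 <= s1 by rewrite mulr_ge0 // subr_ge0.
(* The product is expanded as one contracted term plus an error that is paid
   for by the slack between [proj_rate] and 1 - gap. *)
have es : (1 + e) ^+ 2 * (1 + s1) <= 1 + proj_const * proj_rate ^+ n.+1.
  have h1 : 1 + s1 <= 1 + proj_diam.
    rewrite lerD2l; apply: le_trans ss; rewrite /s1 ler_piMl //; lra.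
  have en : e <= c * proj_rate ^+ n.
    rewrite /e ler_wpM2l //; apply: (@le_trans _ _ (theta ^+ n)).
      by apply: ler_wiXn2l; rewrite ?leqW // ltW.
    by apply: lerXn2r => //; rewrite nnegrE ltW.
  have ec : e <= c by apply: (le_trans en); rewrite ler_piMr // exprn_ile1 ?ltW.
  have h2 : (1 + e) ^+ 2 <= 1 + (2 * c + c ^+ 2) * proj_rate ^+ n.
    have -> : (1 + e) ^+ 2 = 1 + (2 * e + e * e) by ring.
    have -> : (2 * c + c ^+ 2) * proj_rate ^+ n =
      2 * (c * proj_rate ^+ n) + c * (c * proj_rate ^+ n) by ring.
    by rewrite lerD2l; apply: lerD; [rewrite ler_wpM2l|exact: ler_pM].
  have r_ge0 : 0 <= proj_rate ^+ n by rewrite exprn_ge0 // ltW.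
  have c2 : 0 <= (2 * c + c ^+ 2) * proj_rate ^+ n.
    by rewrite mulr_ge0 // addr_ge0 ?mulr_ge0 ?sqr_ge0.
  have h3 : s1 <= (1 - gap) * (proj_const * proj_rate ^+ n).
    by rewrite /s1 ler_wpM2l // subr_ge0.
  have h4 : (2 * c + c ^+ 2) * (1 + proj_diam) <= proj_const * (gap / 2).
    rewrite /proj_const [leRHS]mulrDl -[leLHS]add0r; apply: lerD.
      by rewrite mulr_ge0 // divr_ge0 // ltW.
    by rewrite le_eqVlt; apply/orP; left; apply/eqP; field; rewrite gt_eqF.
  have h5 : proj_const * (gap / 2) <= proj_const * (proj_rate - (1 - gap)).
    by rewrite ler_wpM2l //; lra.
  have h6 : (1 + e) ^+ 2 * (1 + s1) <= 1 + s1 +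
      (2 * c + c ^+ 2) * proj_rate ^+ n * (1 + proj_diam).
    apply: (@le_trans _ _ ((1 + (2 * c + c ^+ 2) * proj_rate ^+ n) * (1 + s1))).
      by rewrite ler_wpM2r // addr_ge0.
    by rewrite mulrDl mul1r lerD2l ler_wpM2l.
  have h7 : (2 * c + c ^+ 2) * (1 + proj_diam) * proj_rate ^+ n <=
      proj_const * (proj_rate - (1 - gap)) * proj_rate ^+ n.
    by rewrite ler_wpM2r // (le_trans h4).
  have -> : proj_const * proj_rate ^+ n.+1 =
      proj_const * (proj_rate - (1 - gap)) * proj_rate ^+ n +
      (1 - gap) * (proj_const * proj_rate ^+ n) by rewrite exprS; ring.
  move: h6; rewrite [_ * proj_rate ^+ n * (1 + _)]mulrAC => h6.
  by apply: (le_trans h6); rewrite -addrA lerD2l addrC lerD.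
move=> i l; rewrite row_sumsS.
have Q0 z : 0 < mxapply (M x) (row_sums k (Defs.shift x)) z.
  by apply: mxapply_gt0 => //; exact: M_gt0.
have W0 z : 0 < row_sums k'.+1 y z by apply: row_sums_gt0.
apply: (@le_trans _ _ ((1 + e) ^+ 2 * (1 + s1) *
    (mxapply (M x) (row_sums k (Defs.shift x)) l * row_sums k'.+1 y i))); last first.
  by rewrite [row_sums k.+1 x l]row_sumsS ler_wpM2r // mulr_ge0 // ltW.
apply: (@le_trans _ _ (mxapply (M x) (row_sums k (Defs.shift x)) i *
    ((1 + e) * mxapply (M x) (row_sums k' (Defs.shift y)) l))).
  by rewrite ler_wpM2l // ltW.
rewrite mulrCA expr2 -!mulrA ler_wpM2l ?addr_ge0 //.
apply: (le_trans (vw1 i l)); rewrite [leRHS]mulrCA ler_wpM2l ?addr_ge0 //.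
by rewrite [leRHS]mulrCA ler_wpM2l // ltW.
Qed.

(** A multiplicative cocycle of matrices becomes an additive one only after this
    passage to the ratio of consecutive norms. *)
Definition log_growth (n : nat) (x : nat -> 'I_m) : R :=
  ln (sum_norm (cocycle M n.+1 x)) - ln (sum_norm (cocycle M n (Defs.shift x))).

Definition log_growth_bound : R := `|ln (d%:R * a)| + `|ln (d%:R * b)|.

Lemma norm_log_growth_le n x : subshift A x -> `|log_growth n x| <= log_growth_bound.
Proof.
move=> Ax; have b0 := b_gt0 Ax; have d0 : 0 < d%:R :> R by rewrite ltr0n.
have X0 := sum_norm_gt0 n (subshift_shift Ax).
have Y0 := sum_norm_gt0 n.+1 Ax.
have da0 : 0 < d%:R * a by rewrite mulr_gt0.
have db0 : 0 < d%:R * b by rewrite mulr_gt0.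
have /andP[h1 h2] := sum_norm_bounds n Ax.
have g1 : ln (d%:R * a) + ln (sum_norm (cocycle M n (Defs.shift x))) <=
    ln (sum_norm (cocycle M n.+1 x)).
  by rewrite -lnM ?posrE // ler_ln ?posrE // mulr_gt0.
have g2 : ln (sum_norm (cocycle M n.+1 x)) <=
    ln (d%:R * b) + ln (sum_norm (cocycle M n (Defs.shift x))).
  by rewrite -lnM ?posrE // ler_ln ?posrE // mulr_gt0.
rewrite /log_growth /log_growth_bound.
move: (ler_norm (ln (d%:R * b))) (lerNnormlW (lexx `|ln (d%:R * a)|)).
move: (normr_ge0 (ln (d%:R * a))) (normr_ge0 (ln (d%:R * b))).
by rewrite ler_norml; lra.
Qed.

(** The ratio of norms is the growth of the sum of the coordinates under one
    matrix, a function of the direction of a vector: so it inherits the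
    closeness of the directions and of the matrices. *)
Lemma log_growth_regular n x y k k' : subshift A x -> subshift A y ->
  agree n.+2 x y -> (n < k)%N -> (n < k')%N ->
  log_growth k x <= log_growth k' y + (c + proj_const) * proj_rate ^+ n.
Proof.
move=> Ax Ay xy nk nk'.
have Ax' := subshift_shift Ax; have Ay' := subshift_shift Ay.
have vw := proj_close_row_sums Ax' Ay' (agree_shift xy) nk nk'.
have [r0 r1 rt _] := proj_rate_bounds Ax.
set s := proj_const * _ in vw; set e := c * theta ^+ n.+2.
have e0 : 0 <= e by rewrite mulr_ge0 ?exprn_ge0 // ltW.
have s0 : 0 <= s.
  rewrite mulr_ge0 ?exprn_ge0 ?(ltW r0) //.
  exact: le_trans (proj_diam_ge0 Ax) (proj_const_ge Ax).
have en : e <= c * proj_rate ^+ n.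
  rewrite /e ler_wpM2l //; apply: (@le_trans _ _ (theta ^+ n)).
    by apply: ler_wiXn2l; rewrite ?leqW // ltW.
  by apply: lerXn2r => //; rewrite nnegrE ltW.
have h : sum_norm (cocycle M k.+1 x) * sum_norm (cocycle M k' (Defs.shift y)) <=
    expR (e + s) * (sum_norm (cocycle M k (Defs.shift x)) * sum_norm (cocycle M k'.+1 y)).
  apply: (@le_trans _ _ ((1 + e) * (1 + s) *
    (sum_norm (cocycle M k (Defs.shift x)) * sum_norm (cocycle M k'.+1 y)))); last first.
    apply: ler_wpM2r; first by rewrite mulr_ge0 // ltW // sum_norm_gt0.
    by rewrite expRD; apply: ler_pM; rewrite ?expR_ge1Dx ?addr_ge0.
  rewrite !sum_norm_row_sums.
  have -> : \sum_i row_sums k.+1 x i =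
      \sum_i mxapply (M x) (row_sums k (Defs.shift x)) i.
    by apply: eq_bigr => i _; rewrite row_sumsS.
  have -> : \sum_i row_sums k'.+1 y i =
      \sum_i mxapply (M y) (row_sums k' (Defs.shift y)) i.
    by apply: eq_bigr => i _; rewrite row_sumsS.
  move: vw (row_sums_gt0 k Ax') (row_sums_gt0 k' Ay').
  move: (row_sums k _) (row_sums k' _) => v w vw v0 w0.
  rewrite mulr_suml mulr_sumr mulr_sumr; apply: ler_sum => i _.
  rewrite /mxapply mulr_suml mulr_sumr mulr_sumr; apply: ler_sum => l _.
  rewrite mulr_suml !mulr_sumr; apply: ler_sum => j _.
  rewrite -mulrA.
  apply: (@le_trans _ _ (((1 + e) * M y i l) * ((1 + s) * (v j * w l)))).
    apply: ler_pM; [exact/ltW/M_gt0| |exact: M_regular|exact: vw].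
    by rewrite mulr_ge0 // ltW.
  by rewrite le_eqVlt; apply/orP; left; apply/eqP; ring.
move: h; rewrite -ler_ln ?posrE ?mulr_gt0 ?expR_gt0 ?sum_norm_gt0 //.
rewrite !lnM ?posrE ?mulr_gt0 ?expR_gt0 ?sum_norm_gt0 // expRK mulrDl -/s /log_growth.
move: (ln _) (ln _) (ln _) (ln _) => x1 x2 x3 x4; lra.
Qed.

(** * From cylinders to weighted words *)

Variables (succ : 'I_m -> 'I_m) (i0 : 'I_m).
Hypothesis succ_allowed : forall i, A i (succ i) = 1%N.

Definition allowed (i j : 'I_m) : bool := A i j == 1%N.

(** The infinite path j J completed by following [succ] from its last letter. *)
Fixpoint extend (j : 'I_m) (J : seq 'I_m) : nat -> 'I_m := fun k =>
  if k is k'.+1 then if J is l :: J' then extend l J' k' else iter k succ j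
  else j.

Lemma extend_subshift j J : path allowed j J -> subshift A (extend j J).
Proof.
elim: J j => [|l J IH] j /=; first by move=> _ [|k]; exact: succ_allowed.
move=> /andP[/eqP jl lJ] [|k]; last exact: IH.
by case: J {IH lJ}.
Qed.

Lemma extend_nth j J k i : (k <= size J)%N -> extend j J k = nth i (j :: J) k.
Proof. by elim: J j k => [|l J IH] j [|k] //= kJ; exact: IH. Qed.

Lemma extend_agree j J b1 b2 :
  agree (size J).+1 (extend j (J ++ b1)) (extend j (J ++ b2)).
Proof.
elim: J j => [|l J IH] j [|k] //; first by case: b1; case: b2.
by rewrite /= ltnS => kJ; exact: IH.
Qed.

Definition word_point (J : seq 'I_m) : nat -> 'I_m :=
  if J is j :: J' then extend j J' else extend i0 [::].

Definition word_log (J : seq 'I_m) : R :=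
  ln (sum_norm (cocycle M (size J) (word_point J))).

Lemma word_point_subshift J : sorted allowed J -> subshift A (word_point J).
Proof. by case: J => [|j J] sJ; apply: extend_subshift. Qed.

Lemma incr_word_log j J : incr word_log (j :: J) = log_growth (size J) (extend j J).
Proof.
rewrite /incr /word_log /log_growth; congr (_ - ln (sum_norm _)).
by case: J => //=; rewrite /cocycle !big_ord0.
Qed.

Lemma norm_incr_word_log w : sorted allowed w ->
  `|incr word_log w| <= log_growth_bound.
Proof.
case: w => [|j w] sw; first by rewrite /incr subrr normr0 addr_ge0.
by rewrite incr_word_log norm_log_growth_le //; exact: extend_subshift.
Qed.

(** The first term accounts for the two letters by which [log_growth_regular]
    lags behind the length of the common prefix, the second one for prefixes of
    a single letter, where only boundedness is available. *)
Definition word_reg : R :=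
  (c + proj_const) / proj_rate ^+ 2 + 2 * log_growth_bound / proj_rate.

Lemma incr_word_log_regular w b1 b2 : w != [::] ->
  sorted allowed (w ++ b1) -> sorted allowed (w ++ b2) ->
  incr word_log (w ++ b1) <=
    incr word_log (w ++ b2) + word_reg * proj_rate ^+ size w.
Proof.
case: w => // j w _ s1 s2.
have A1 := extend_subshift s1; have A2 := extend_subshift s2.
have [r0 r1 _ _] := proj_rate_bounds A1.
have C0 : 0 <= proj_const := le_trans (proj_diam_ge0 A1) (proj_const_ge A1).
have L0 : 0 <= log_growth_bound by rewrite addr_ge0.
have n1 := norm_log_growth_le (size (w ++ b1)) A1.
have n2 := norm_log_growth_le (size (w ++ b2)) A2.
rewrite /= !incr_word_log; case: w s1 s2 A1 A2 n1 n2 => [|l w] s1 s2 A1 A2 n1 n2.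
  have -> : word_reg * proj_rate ^+ (size (T := 'I_m) [::]).+1 =
      (c + proj_const) / proj_rate + 2 * log_growth_bound.
    by rewrite /word_reg /= expr1; field; rewrite gt_eqF.
  have : 0 <= (c + proj_const) / proj_rate.
    by apply: divr_ge0; [exact: addr_ge0|exact: ltW].
  by move: n1 n2; rewrite !ler_norml; lra.
apply: (le_trans (log_growth_regular (n := size w)
  (k' := size ((l :: w) ++ b2)) A1 A2 _ _ _)).
- exact: (@extend_agree j (l :: w) b1 b2).
- by rewrite /= ltnS size_cat leq_addr.
- by rewrite /= ltnS size_cat leq_addr.
have -> : word_reg * proj_rate ^+ (size w).+2 = (c + proj_const) * proj_rate ^+ size w +
    2 * log_growth_bound * proj_rate ^+ (size w).+1.
  by rewrite /word_reg !exprS; field; rewrite gt_eqF.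
by rewrite lerD2l lerDl mulr_ge0 ?exprn_ge0 ?mulr_ge0 // ltW.
Qed.

(** A negative power reverses the order of the norms; bounded distortion is
    two-sided and so covers both signs of s. *)
Lemma sup_cylinder n (J : n.-tuple 'I_m) (s : R) : (0 < n)%N -> admissible A J ->
  expR (s * word_log J) <=
    sup [set sum_norm (cocycle M n x) `^ s | x in cylinder A J] <=
  expR (`|s| * (c / (1 - theta))) * expR (s * word_log J).
Proof.
move=> n0 sJ; have AJ : subshift A (word_point J) := word_point_subshift sJ.
have JC : cylinder A J (word_point J).
  split=> // i; rewrite (tnth_nth i0).
  case: J sJ AJ => -[|j J] /= /eqP szJ _ _; first by rewrite -szJ in n0.
  by apply: extend_nth; have := ltn_ord i; rewrite -{2}szJ.
have powE x : subshift A x ->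
    sum_norm (cocycle M n x) `^ s = expR (s * ln (sum_norm (cocycle M n x))).
  by move=> Ax; rewrite /powR gt_eqF ?sum_norm_gt0.
have wE : word_log J = ln (sum_norm (cocycle M n (word_point J))).
  by rewrite /word_log size_tuple.
have ub : ubound [set sum_norm (cocycle M n x) `^ s | x in cylinder A J]
    (expR (`|s| * (c / (1 - theta))) * expR (s * word_log J)).
  move=> _ [x [Ax xJ] <-]; rewrite powE // -expRD ler_expR wE.
  have xy : agree n x (word_point J).
    by move=> k kn; rewrite (xJ (Ordinal kn)); have [_ /(_ (Ordinal kn))] := JC.
  have yx : agree n (word_point J) x by move=> k kn; rewrite xy.
  have := sum_norm_distortion Ax AJ xy; have := sum_norm_distortion AJ Ax yx.
  set E := c / _; set u := ln _; set v := ln _ => h1 h2.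
  rewrite -lerBlDr -mulrBr; apply: (le_trans (ler_norm _)); rewrite normrM ler_wpM2l //.
  by rewrite ler_norml; lra.
apply/andP; split.
  rewrite wE -powE //; apply: ub_le_sup.
    by exists (expR (`|s| * (c / (1 - theta))) * expR (s * word_log J)).
  by exists (word_point J).
apply: ge_sup => //; exists (sum_norm (cocycle M n (word_point J)) `^ s).
by exists (word_point J).
Qed.

Lemma cylinder_sum n (s : R) : (0 < n)%N ->
  expR (s * word_log [::]) * weight allowed word_log s n [::] <=
    \sum_(J : n.-tuple 'I_m | admissible A J)
      sup [set sum_norm (cocycle M n x) `^ s | x in cylinder A J] <=
  expR (`|s| * (c / (1 - theta))) *
    (expR (s * word_log [::]) * weight allowed word_log s n [::]).
Proof.
move=> n0.
have -> : expR (s * word_log [::]) * weight allowed word_log s n [::] =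
    \sum_(J : n.-tuple 'I_m | admissible A J) expR (s * word_log J).
  rewrite weight_nil mulr_sumr; apply: eq_bigr => J _.
  by rewrite -expRD; congr expR; ring.
rewrite mulr_sumr; apply/andP; split; apply: ler_sum => J sJ;
  by have /andP[] := sup_cylinder s n0 sJ.
Qed.

Variable p : nat.
Hypothesis p_gt0 : (0 < p)%N.
Hypothesis words_mixing : forall i w, sorted allowed w ->
  exists a, [/\ size a = p, sorted allowed (a ++ w) & ohead a = Some i].

Lemma pressure_derivable_of_bounds q : derivable (pressure A M) q 1.
Proof.
have A0 : subshift A (extend i0 [::]) by exact: extend_subshift.
have [r0 r1 _ _] := proj_rate_bounds A0.
have C0 : 0 <= proj_const := le_trans (proj_diam_ge0 A0) (proj_const_ge A0).
have L0 : 0 <= log_growth_bound by rewrite addr_ge0.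
have W0 : 0 <= word_reg.
  have r_ge0 : 0 <= proj_rate by exact: ltW.
  by apply: addr_ge0; apply: divr_ge0; rewrite ?exprn_ge0 ?mulr_ge0 // addr_ge0.
have m0 : (0 < #|'I_m|)%N by apply/card_gt0P; exists i0.
apply: (growth_rate_derivable L0 W0 r0 r1 p_gt0 m0 norm_incr_word_log
  incr_word_log_regular words_mixing) => s.
exists (`|s * word_log [::]| + `|s| * (c / (1 - theta))) => n n0.
have w0 : 0 < weight allowed word_log s n [::].
  exact: (weight_gt0 word_log p_gt0 m0 words_mixing).
have /andP[] := cylinder_sum s n0; set Z := \sum_(J | _) _ => h1 h2.
have Z0 : 0 < Z by apply: lt_le_trans h1; rewrite mulr_gt0 ?expR_gt0.
move: h1 h2; rewrite -ler_ln ?posrE ?mulr_gt0 ?expR_gt0 // => h1.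
rewrite -ler_ln ?posrE ?mulr_gt0 ?expR_gt0 // => h2; move: h1 h2.
rewrite !lnM ?posrE ?mulr_gt0 ?expR_gt0 // !expRK.
have := ler_norm (s * word_log [::]); have := lerNnormlW (lexx `|s * word_log [::]|).
have : 0 <= `|s| * (c / (1 - theta)) by rewrite mulr_ge0 ?divr_ge0 ?subr_ge0 // ltW.
by rewrite ler_norml; lra.
Qed.

End CocycleEstimates.

(** * Uniform bounds from compactness and the Hoelder condition *)

Section UniformBounds.

Variables (R : realType) (m : nat) (A : 'M[nat]_m).

Lemma uniform_positive (I : finType) (Q : I -> R -> Prop) :
  (forall i a a', a' <= a -> Q i a -> Q i a') ->
  (forall i, exists2 a, 0 < a & Q i a) -> exists2 a, 0 < a & forall i, Q i a.
Proof.
move=> Qle Qex; have [f hf] := choice (fun i => let: ex_intro2 a a0 Qa := Qex i in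
  ex_intro (fun a => 0 < a /\ Q i a) a (conj a0 Qa)).
exists (\big[Num.min/1]_i f i).
  by apply: lt_bigmin => // i _; have [] := hf i.
by move=> i; have [_] := hf i; apply: Qle; exact: bigmin_le_cond.
Qed.

Lemma agree_mkseq (x y : nat -> 'I_m) n : mkseq x n = mkseq y n -> agree n x y.
Proof.
by move=> xy k kn; rewrite -(nth_mkseq (x 0) x kn) xy nth_mkseq.
Qed.

(** Compactness of the subshift, as Koenig's lemma: if the infimum is 0, it is 0
    on some one-letter extension of every cylinder on which it is 0; the nested
    cylinders single out a point where f vanishes by continuity. *)
Lemma subshift_lower_bound (f : (nat -> 'I_m) -> R) :
  (forall eps : R, 0 < eps -> exists n, forall x y, subshift A x -> subshift A y ->
     agree n x y -> `|f x - f y| < eps) ->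
  (forall x, subshift A x -> 0 < f x) ->
  exists2 a : R, 0 < a & forall x, subshift A x -> a <= f x.
Proof.
move=> fc f0; apply: contrapT => nolb.
pose low J := forall eps : R, 0 < eps ->
  exists x, [/\ subshift A x, mkseq x (size J) = J & f x < eps].
have low_nil : low [::].
  move=> eps eps0; apply: contrapT => nox; apply: nolb; exists eps => // x Ax.
  by rewrite leNgt; apply/negP => fx; apply: nox; exists x.
have low_ext J : exists k, low J -> low (rcons J k).
  apply: contrapT => nok.
  have [x0 _] := low_nil 1 ltr01.
  have lowJ : low J by apply: contrapT => nJ; apply: nok; exists (x0 0).
  have [eps eps0 hk] : exists2 eps : R, 0 < eps & forall k x, subshift A x ->
      mkseq x (size J).+1 = rcons J k -> eps <= f x.
    apply: uniform_positive => [k a a' aa' h x Ax xJ|k].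
      exact: le_trans (h x Ax xJ).
    apply: contrapT => noe; apply: nok; exists k => _ eps eps0.
    apply: contrapT => nox; apply: noe; exists eps => // x Ax xJ.
    rewrite leNgt; apply/negP => fx; apply: nox; exists x; split=> //.
    by rewrite size_rcons.
  have [x [Ax xJ fx]] := lowJ eps eps0.
  have := hk (x (size J)) x Ax; rewrite mkseqS xJ leNgt fx => /(_ erefl).
  by [].
have [g hg] := choice low_ext.
pose w n := iter n (fun J => rcons J (g J)) [::].
pose x n := g (w n).
have wE n : w n = mkseq x n.
  by elim: n => // n IH; rewrite mkseqS -IH.
have low_w n : low (w n) by elim: n => //= n IH; apply: hg.
have near_x n (eps : R) : 0 < eps -> exists y, [/\ subshift A y, agree n y x & f y < eps].
  move=> eps0; have [y [Ay yw fy]] := low_w n eps eps0.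
  exists y; split=> //; apply: agree_mkseq.
  by rewrite -wE -[in RHS]yw wE size_mkseq.
have Ax : subshift A x.
  move=> k; have [y [Ay yx _]] := near_x k.+2 1 ltr01.
  by rewrite -!yx ?Ay.
have fx := f0 x Ax; have fx2 : 0 < f x / 2 by rewrite divr_gt0.
have [n hn] := fc (f x / 2) fx2.
have [y [Ay yx fy]] := near_x n (f x / 2) fx2.
by have := hn y x Ay Ax yx; rewrite ltr_norml; lra.
Qed.

End UniformBounds.

Lemma norm_entry_le (R : realType) d (P : 'M[R]_d) i j : `|P i j| <= `|P|.
Proof.
rewrite [leRHS]mx_normrE.
exact: (le_bigmax _ (fun ij => `|P ij.1 ij.2|) (i, j)).
Qed.

(** The first disagreement has an index of at least n. *)
Lemma symb_dist_powR (R : realType) m (x y : nat -> 'I_m) (alpha : R) n :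
  (2 <= m)%N -> 0 < alpha -> agree n x y ->
  symb_dist R x y `^ alpha <= (m%:R^-1 `^ alpha) ^+ n.
Proof.
move=> m2 al xy; have m0 : 0 < m%:R :> R by rewrite ltr0n ltnW.
have mi1 : m%:R^-1 < 1 :> R by rewrite invf_lt1 // ltr1n.
have th1 : m%:R^-1 `^ alpha <= 1 :> R.
  rewrite [leRHS](_ : 1 = 1 `^ alpha); last by rewrite powR1.
  apply: ge0_ler_powR; rewrite ?nnegrE ?invr_ge0 //; exact: ltW.
have th0 : 0 <= m%:R^-1 `^ alpha :> R by exact: powR_ge0.
rewrite /symb_dist; case: pselect => [neq|_]; last first.
  by rewrite powR0 ?exprn_ge0 // gt_eqF.
case: ex_minnP => k xyk _.
have nk : (n <= k)%N.
  by rewrite leqNgt; apply: contra xyk => kn; rewrite (xy k kn).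
have -> : (m%:R ^- k.+1) `^ alpha = (m%:R^-1 `^ alpha) ^+ k.+1.
  have i0 : 0 <= m%:R^-1 :> R by rewrite invr_ge0 ltW.
  by rewrite -exprVn -(powR_mulrn k.+1 i0) -(powR_mulrn k.+1 th0) powRAC.
by apply: ler_wiXn2l => //; rewrite leqW.
Qed.

Lemma hoelder_entries (R : realType) m d (A : 'M[nat]_m)
    (M : (nat -> 'I_m) -> 'M[R]_d) : (2 <= m)%N -> hoelder_on (subshift A) M ->
  exists C theta : R, [/\ 0 <= C, 0 < theta < 1 &
    forall n x y, subshift A x -> subshift A y -> agree n x y ->
      forall i j, `|M x i j - M y i j| <= C * theta ^+ n].
Proof.
move=> m2 [C [alpha [al hM]]].
have m0 : 0 < m%:R :> R by rewrite ltr0n ltnW.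
exists `|C|, (m%:R^-1 `^ alpha); split=> //.
  rewrite powR_gt0 ?invr_gt0 //= [ltRHS](_ : 1 = 1 `^ alpha); last by rewrite powR1.
  by apply: gt0_ltr_powR; rewrite ?nnegrE ?invr_ge0 ?ler01 ?(ltW m0) ?invf_lt1 ?ltr1n.
move=> n x y Ax Ay xy i j.
have -> : M x i j - M y i j = (M x - M y) i j by rewrite !mxE.
apply: (le_trans (norm_entry_le _ _ _)); apply: (le_trans (hM x y Ax Ay)).
apply: (@le_trans _ _ (`|C| * symb_dist R x y `^ alpha)).
  by rewrite ler_wpM2r ?powR_ge0 ?ler_norm.
by rewrite ler_wpM2l // symb_dist_powR.
Qed.

(** * Paths of a primitive matrix and the differentiability of the pressure *)

Lemma mx_pow_path (m : nat) (A : 'M[nat]_m) p i j : zero_one_mx A ->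
  (0 < (A ^+ p) i j)%N ->
  exists s, [/\ size s = p, path (allowed A) i s & last i s = j].
Proof.
move=> A01; elim: p i => [|p IH] i.
  rewrite expr0 mxE; case: eqP => // -> _; by exists [::].
rewrite exprS mxE => pos.
have [k /andP[Aik kj]] : exists k, (0 < A i k)%N && (0 < (A ^+ p) k j)%N.
  apply: contrapT => nok; move: pos; rewrite big1 // => k _.
  have [h|h] := posnP (A i k); first by rewrite h mul0r.
  have [h'|h'] := posnP ((A ^+ p) k j); first by rewrite h' mulr0.
  by exfalso; apply: nok; exists k; rewrite h h'.
have [s [ss ps ls]] := IH k kj; exists (k :: s); split; rewrite /= ?ss //.
by rewrite ps /allowed andbT; case: (A01 i k) => h; rewrite h // in Aik *.
Qed.

(** A path of length p from i to the first letter of w, without its end point;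
    if w is empty any end point will do. *)
Lemma primitive_mixing (m : nat) (A : 'M[nat]_m) p : zero_one_mx A -> (0 < p)%N ->
  (forall i j, (0 < (A ^+ p) i j)%N) ->
  forall i w, sorted (allowed A) w ->
  exists a, [/\ size a = p, sorted (allowed A) (a ++ w) & ohead a = Some i].
Proof.
move=> A01 p0 Ap i w sw; pose j := if w is j :: _ then j else i.
have [s [ss ps ls]] := mx_pow_path A01 (Ap i j).
have hd : ohead (belast i s) = Some i by case: s ss {ps ls} => // ss; rewrite -ss in p0.
exists (belast i s); split=> //; first by rewrite size_belast.
case: w sw @j ls => [|j w] sw j' ls.
  rewrite cats0; move: ps; rewrite -[path _ _ _]/(sorted _ (i :: s)) lastI -cats1.
  by move=> /cat_sorted2[].
by rewrite -cat_rcons -[j]ls -lastI /= cat_path ps ls.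
Qed.

Theorem theorem1p2 (R : realType) (m d : nat) (A : 'M[nat]_m)
    (M : (nat -> 'I_m) -> 'M[R]_d)
    (hm : (2 <= m)%N) (hd : (1 <= d)%N)
    (hA01 : zero_one_mx A) (hAprim : primitive_mx A)
    (hMpos : forall x, subshift A x -> positive_mx (M x))
    (hMhoelder : hoelder_on (subshift A) M)
    (q : R) (hq : q != 0) :
  derivable (pressure A M) q 1.
Proof.
have [p p0 Ap] := hAprim.
have m0 : (0 < m)%N by exact: ltnW.
pose i0 := Ordinal m0.
have mix := primitive_mixing hA01 p0 Ap.
have succ_ex i : exists k, A i k = 1%N.
  have [[|k s] [ss ps _]] := mx_pow_path hA01 (Ap i i); first by rewrite -ss in p0.
  by exists k; move: ps => /= /andP[/eqP].
have [succ hsucc] := choice succ_ex.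
have A0 : subshift A (extend succ i0 [::]) by exact: extend_subshift.
have [C [theta [C0 /andP[t0 t1] hC]]] := hoelder_entries hm hMhoelder.
have [a a0 alo] : exists2 a : R, 0 < a & forall (ij : 'I_d * 'I_d) x,
    subshift A x -> a <= M x ij.1 ij.2.
  apply: uniform_positive => [ij a a' aa' h x Ax|[i j]].
    exact: le_trans (h x Ax).
  apply: subshift_lower_bound => [eps eps0|x Ax]; last exact: hMpos.
  have : (C * theta ^+ n) @[n --> \oo] --> C * 0.
    apply: cvgMr; apply: cvg_expr; rewrite ger0_norm //; exact: ltW.
  rewrite mulr0 => /cvgrPdist_lt/(_ eps eps0)[N _ hN]; exists N => x y Ax Ay xy.
  apply: (le_lt_trans (hC N x y Ax Ay xy i j)).
  have := hN N (leqnn N); rewrite sub0r normrN ger0_norm //.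
  by rewrite mulr_ge0 ?exprn_ge0 // ltW.
have M_bounds x : subshift A x -> forall i j,
    a <= M x i j <= `|M (extend succ i0 [::])| + C.
  move=> Ax i j; rewrite (alo (i, j)) //=.
  have agree0 : agree 0 x (extend succ i0 [::]) by [].
  have := hC 0%N x _ Ax A0 agree0 i j; rewrite expr0 mulr1.
  by have := norm_entry_le (M (extend succ i0 [::])) i j; rewrite !ler_norml; lra.
apply: (@pressure_derivable_of_bounds R m d A M a _ (C / a) theta
  hd a0 M_bounds _ t0 t1 _ succ i0 hsucc p p0 mix).
  by rewrite divr_ge0 // ltW.
move=> n x y Ax Ay xy i j.
have := hC n x y Ax Ay xy i j; rewrite ler_norml => /andP[_ h].
have : C * theta ^+ n <= C / a * theta ^+ n * M y i j.
  have -> : C / a * theta ^+ n * M y i j = C * theta ^+ n * (M y i j / a) by ring.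
  rewrite ler_peMr ?ler_pdivlMr ?mul1r ?(alo (i, j)) //.
  by rewrite mulr_ge0 // exprn_ge0 // ltW.
by rewrite mulrDl mul1r; lra.
Qed.
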